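(* Let $G$ be a discrete group and $\sigma$ a multiplier on $G$. The following conditions are equivalent: (i) $(G,\sigma)$ satisfies condition K. (ii) The twisted group von Neumann algebra $W^*(G,\sigma)$ is a factor. (iii) The reduced twisted group $C^*$-algebra $C^*_r(G,\sigma)$ is prime. (iv) $C^*_r(G,\sigma)$ has trivial center.
   Context: A multiplier on a discrete group $G$ (identity $e$) is a function $\sigma:G\times G\to\mathbb{T}$ with $\sigma(a,b)\sigma(ab,c)=\sigma(a,bc)\sigma(b,c)$ and $\sigma(a,e)=\sigma(e,a)=1$ for all $a,b,c\in G$. The left regular $\sigma$-projective unitary representation $\lambda_\sigma$ of $G$ on $\ell^2(G)$ is given by $(\lambda_\sigma(a)\xi)(b)=\sigma(a,a^{-1}b)\xi(a^{-1}b)$, i.e. $\lambda_\sigma(a)\delta_b=\sigma(a,b)\delta_{ab}$. $C^*_r(G,\sigma)$ and $W^*(G,\sigma)$ are, respectively, the $C^*$-algebra and the von Neumann algebra on $\ell^2(G)$ generated by $\lambda_\sigma(G)$. An element $a\in G$ is $\sigma$-regular if $\sigma(a,b)=\sigma(b,a)$ whenever $b\in G$ commutes with $a$. If $a$ is $\sigma$-regular then so is every conjugate of $a$, so one speaks of $\sigma$-regular conjugacy classes. The pair $(G,\sigma)$ satisfies condition K if every nontrivial (i.e. $\neq\{e\}$) $\sigma$-regular conjugacy class of $G$ is infinite. A $C^*$-algebra is prime if any two nonzero (closed two-sided) ideals have nonzero intersection. A unital $C^*$-algebra has trivial center if its center consists of the scalar multiples of the identity. *)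

(* Defs.v *)
From HB Require Import structures.
From mathcomp Require Import all_boot all_order all_algebra.
From mathcomp Require Import complex.
From mathcomp Require Import all_classical all_reals.
From mathcomp Require Import ereal numfun esum.
From mathcomp Require Import ring.

Set Implicit Arguments.
Unset Strict Implicit.
Unset Printing Implicit Defensive.

Import Order.TTheory GRing.Theory Num.Theory.
Import complex.ComplexField.Normc.

Local Open Scope classical_set_scope.
Local Open Scope ring_scope.
Local Open Scope complex_scope.

(* The topology of a discrete group carries no information: G is an arbitrary
   group, given as a groupType (written multiplicatively in %g). *)

Record multiplier (R : realType) (G : groupType) := Multiplier {
  mult_fun :> G -> G -> R[i];
  multT : forall a b, `|mult_fun a b| = 1;
  multA : forall a b c, mult_fun a b * mult_fun (a * b)%g c =
                        mult_fun a (b * c)%g * mult_fun b c;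
  mult1r : forall a, mult_fun a 1%g = 1;
  mult1l : forall a, mult_fun 1%g a = 1 }.

Section ell2.
Variables (R : realType) (G : groupType).
Implicit Types (x y : G -> R[i]) (g : G).

Definition square_summable : {pred (G -> R[i])} :=
  [pred x | `[< summable setT (fun g => (normc (x g) ^+ 2)%:E) >]].

Lemma square_summableP x :
  reflect (\esum_(g in setT) (normc (x g) ^+ 2)%:E < +oo)%E
          (x \in square_summable).
Proof.
rewrite inE /= /summable (@eq_esum _ _ _ _ (fun g => (normc (x g) ^+ 2)%:E)).
  exact: asboolP.
by move=> g _; rewrite gee0_abs // lee_fin sqr_ge0.
Qed.

Lemma square_summable_submod : submod_closed square_summable.
Proof.
split=> [|a x y /square_summableP xs /square_summableP ys].
  apply/square_summableP; rewrite esum1 // => g _.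
  by rewrite (_ : (0 : G -> R[i]) g = 0%C) // normc0 expr0n.
apply/square_summableP.
pose f z g : \bar R := (normc (z g : R[i]) ^+ 2)%:E.
have f0 z g : (0 <= f z g)%E by rewrite lee_fin sqr_ge0.
pose k : R := normc a ^+ 2 *+ 2.
have k0 : 0 <= k by rewrite mulrn_wge0 ?sqr_ge0.
have scale_lty (z : G -> R[i]) (c : R) : 0 <= c ->
    (\esum_(g in setT) f z g < +oo)%E ->
    (\esum_(g in setT) (c%:E * f z g) < +oo)%E.
  move=> c0 zs; apply: (@le_lt_trans _ _ (c%:E * \esum_(g in setT) f z g)%E).
    apply: ub_ereal_sup => _ [A [finA _] <-].
    rewrite -ge0_mule_fsumr //; apply: lee_wpmul2l; first by rewrite lee_fin.
    by apply: ereal_sup_ubound; exists A.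
  by apply: lte_mul_pinfty => //; rewrite ?lee_fin.
have := lte_add_pinfty (scale_lty _ _ k0 xs) (scale_lty _ 2 (ler0n _ 2) ys).
rewrite -esumD; last 2 first.
- by move=> g _; apply: mule_ge0; [rewrite lee_fin | exact: f0].
- by move=> g _; apply: mule_ge0; [rewrite lee_fin ler0n | exact: f0].
apply: le_lt_trans; apply: le_esum => g _; rewrite /f lee_fin /k.
set u := normc (x g); set v := normc (y g).
have h : normc ((a *: x + y) g) <= normc a * u + v.
  by apply: le_trans (le_normcD _ _) _; rewrite normcM.
have n0 z : 0 <= normc (z : R[i]) by case: z => p q; exact: sqrtr_ge0.
apply: (@le_trans _ _ ((normc a * u + v) ^+ 2)).
  by rewrite ler_sqr ?nnegrE ?addr_ge0 ?mulr_ge0 ?n0.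
rewrite -subr_ge0.
suff -> : normc a ^+ 2 *+ 2 * u ^+ 2 + 2 * v ^+ 2 - (normc a * u + v) ^+ 2 =
          (normc a * u - v) ^+ 2 by exact: sqr_ge0.
rewrite sqrrD sqrrB exprMn !mulr2n; ring.
Qed.

HB.instance Definition _ := GRing.isSubmodClosed.Build R[i] (G -> R[i])
  square_summable square_summable_submod.

Record ell2 := Ell2 {
  ell2_fun :> G -> R[i];
  ell2P : ell2_fun \in square_summable }.

HB.instance Definition _ := [isSub for ell2_fun].
HB.instance Definition _ := [Choice of ell2 by <:].
HB.instance Definition _ := [SubChoice_isSubLmodule of ell2 by <:].

Definition l2norm (xi : ell2) : R :=
  Num.sqrt (fine (\esum_(g in setT) (normc (xi g) ^+ 2)%:E)).

(* Unconditional sums over the possibly uncountable index set G, meaningful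
   when the family is absolutely summable. *)
Definition rsum (f : G -> R) : R :=
  fine (\esum_(g in setT) ((EFin \o f)^\+)%E g) -
  fine (\esum_(g in setT) ((EFin \o f)^\-)%E g).

Definition csum (f : G -> R[i]) : R[i] :=
  rsum (fun g => complex.Re (f g)) +i* rsum (fun g => complex.Im (f g)).

Definition l2dot (xi eta : ell2) : R[i] := csum (fun g => xi g * (eta g)^*).

End ell2.

Arguments square_summable {R G}.

Section operators.
Variables (R : realType) (G : groupType).
Local Notation H := (ell2 R G).
Implicit Types (S T : H -> H) (A M I J : set (H -> H)).

Definition bounded_operator T : Prop :=
  linear T /\ exists c : R, forall xi, l2norm (T xi) <= c * l2norm xi.

Definition adjoint_of T S : Prop :=
  forall xi eta, l2dot (T xi) eta = l2dot xi (S eta).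

Definition norm_closed A : Prop := forall T, bounded_operator T ->
  (forall eps : R, 0 < eps ->
     exists2 S, A S & forall xi, l2norm (T xi - S xi) <= eps * l2norm xi) ->
  A T.

(* A basic weak-operator neighbourhood of T is given by eps > 0 and finitely
   many pairs of vectors. *)
Definition wot_closed A : Prop := forall T, bounded_operator T ->
  (forall (eps : R) (s : seq (H * H)), 0 < eps ->
     exists2 S, A S &
       forall p, p \in s -> normc (l2dot (T p.1 - S p.1) p.2) < eps) ->
  A T.

Record star_subalgebra A : Prop := StarSubalgebra {
  star_bounded : forall T, A T -> bounded_operator T;
  star0 : A 0;
  starD : forall S T, A S -> A T -> A (S + T);
  starZ : forall (a : R[i]) T, A T -> A (a *: T);
  starM : forall S T, A S -> A T -> A (S \o T);
  star_adjoint : forall T S, A T -> adjoint_of T S -> A S }.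

Definition cstar_algebra A : Prop := star_subalgebra A /\ norm_closed A.

Definition von_neumann_algebra M : Prop :=
  [/\ star_subalgebra M, M id & wot_closed M].

Definition algebra_center A : set (H -> H) :=
  [set T | A T /\ forall S, A S -> T \o S = S \o T].

Definition scalar_operators : set (H -> H) :=
  range (fun a : R[i] => a *: (id : H -> H)).

Definition trivial_center A : Prop := algebra_center A = scalar_operators.

Definition is_factor M : Prop := von_neumann_algebra M /\ trivial_center M.

Record closed_ideal A I : Prop := ClosedIdeal {
  ideal_sub : I `<=` A;
  ideal0 : I 0;
  idealD : forall S T, I S -> I T -> I (S + T);
  idealZ : forall (a : R[i]) T, I T -> I (a *: T);
  idealMl : forall S T, A S -> I T -> I (S \o T);
  idealMr : forall S T, I S -> A T -> I (S \o T);
  ideal_closed : norm_closed I }.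

Definition prime_algebra A : Prop := forall I J,
  closed_ideal A I -> closed_ideal A J ->
  I <> [set 0] -> J <> [set 0] -> I `&` J <> [set 0].

End operators.

Section twisted_group_algebras.
Variables (R : realType) (G : groupType) (sigma : multiplier R G).
Implicit Types (a b : G).

Definition lambda_fun a (xi : G -> R[i]) (b : G) : R[i] :=
  sigma a (a^-1 * b)%g * xi (a^-1 * b)%g.

Lemma lambda_square_summable a (xi : ell2 R G) :
  lambda_fun a xi \in square_summable.
Proof.
apply/square_summableP; have /square_summableP := ell2P xi.
rewrite (@reindex_esum _ _ _ setT setT (fun b => (a^-1 * b)%g)) //; last first.
  split=> // [b c _ _ /mulgI //|b _]; exists (a * b)%g => //.
  by rewrite mulKg.
apply: le_lt_trans; apply: le_esum => b _.
have nT z : `|z| = 1 -> normc z = 1 :> R.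
  by rewrite normc_def => -[]; case: z.
by rewrite /lambda_fun lee_fin normcM (nT _ (multT _ _ _)) mul1r.
Qed.

Definition lambda a (xi : ell2 R G) : ell2 R G :=
  Ell2 (lambda_square_summable a xi).

Definition reduced_cstar : set (ell2 R G -> ell2 R G) :=
  smallest (@cstar_algebra R G) (range lambda).

Definition twisted_vN : set (ell2 R G -> ell2 R G) :=
  smallest (@von_neumann_algebra R G) (range lambda).

Definition sigma_regular a : Prop :=
  forall b, commute a b -> sigma a b = sigma b a.

Definition conjugacy_class a : set G := range (fun b => (a ^ b)%g).

Definition regular_class (C : set G) : Prop :=
  exists2 a, sigma_regular a & C = conjugacy_class a.

Definition condition_K : Prop :=
  forall C, regular_class C -> C <> [set 1%g] -> infinite_set C.

End twisted_group_algebras.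

(* Main.v *)
Require Import Defs.
From mathcomp Require Import all_boot all_order all_algebra.
From mathcomp Require Import complex.
From mathcomp Require Import all_classical all_reals.
From mathcomp Require Import ereal numfun esum.
From mathcomp Require Import ring lra.

(** All four conditions are compared with condition K through the vector
    x = T (delta 1) attached to an operator T. Besides the left translations
    lambda_b there are right translations rho_b, twisted by the same multiplier,
    which commute with them; hence with every operator of C*_r(G, sigma) and of
    W*(G, sigma), by [commutant_von_neumann].

    K implies the other conditions. If x is a vector with lambda_b x = rho_b x
    for all b, then |x| is constant on conjugacy classes and x vanishes off the
    regular ones. As x is square summable, condition K leaves only the
    coefficient at the identity ([K_fixed_vector]). A central operator T gives
    such a vector T (delta 1), which makes T a scalar ([K_trivial_center]); this
    applies to both algebras. For primeness ([K_prime]), two nonzero ideals with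
    trivial intersection would give a closed subspace stable under all left and
    right translations, neither 0 nor everything; the projection of delta 1 on
    it satisfies lambda_b x = rho_b x too, so it is a multiple of delta 1, and
    both possibilities are excluded.

    Each condition implies K. If C is a finite nontrivial regular class, the sum
    of the operators lambda_b lambda_a lambda_b^* over the elements
    c = b a b^-1 of C is central, and one obtains a central self-adjoint k with
    k (delta 1) nonzero and vanishing at 1 ([central_selfadjoint]). It is not a
    scalar, so no algebra between the lambda_a and W*(G, sigma) has trivial
    center ([trivial_center_K]). It also contradicts primeness ([prime_K]): the
    center of a prime C*-algebra has no zero divisors ([prime_center_domain]),
    and with s the square root of k^2 ([sqrt_one_minus]) the relation
    (s - k) (s + k) = 0 forces k = s or k = - s, whereas k has
    <k (delta 1), delta 1> = 0.

    The functional analysis this needs is developed from the definitions of the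
    inner product as an unconditional sum: completeness of l2(G), projection on
    closed subspaces, existence of adjoints. *)

Set Implicit Arguments.
Unset Strict Implicit.
Unset Printing Implicit Defensive.

Import Order.TTheory GRing.Theory Num.Theory.
Import complex.ComplexField.Normc.

Local Open Scope classical_set_scope.
Local Open Scope complex_scope.
Local Open Scope ring_scope.

(** * Unconditional sums of real families *)
Section unconditional_sums.
Variables (R : realType) (G : groupType).
Implicit Types (f g p q : G -> R).

Lemma esumZl (c : R) (a : G -> \bar R) : 0 <= c -> (forall t, 0 <= a t)%E ->
  (\esum_(t in setT) (c%:E * a t) = c%:E * \esum_(t in setT) a t)%E.
Proof.
have le (d : R) (b : G -> \bar R) : 0 <= d -> (forall t, 0 <= b t)%E ->
    (\esum_(t in setT) (d%:E * b t) <= d%:E * \esum_(t in setT) b t)%E.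
  move=> d0 b0; apply: ge_ereal_sup => _ [A [finA _] <-].
  rewrite -ge0_mule_fsumr //; apply: lee_wpmul2l; first by rewrite lee_fin.
  by apply: ereal_sup_ubound; exists A.
rewrite le_eqVlt => /predU1P[<- _|c0 a0].
  by rewrite mul0e esum1 // => t _; rewrite mul0e.
apply/eqP; rewrite eq_le; apply/andP; split; first exact/le/a0/ltW.
rewrite -lee_pdivlMl //; apply: le_trans (le _ _ _ _).
- by apply: le_esum => t _; rewrite muleA -EFinM mulVf ?gt_eqF // mul1e.
- by rewrite invr_ge0 ltW.
- by move=> t; rewrite mule_ge0 ?lee_fin ?(ltW c0).
Qed.

Definition abs_summable f := summable setT (EFin \o f).

Lemma abs_summable_le f p : (forall t, `|f t| <= p t) ->
  (\esum_(t in setT) (p t)%:E < +oo)%E -> abs_summable f.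
Proof.
by move=> fp; apply: le_lt_trans; apply: le_esum => t _; rewrite lee_fin.
Qed.

Lemma abs_summable_fin p : (forall t, 0 <= p t) -> abs_summable p ->
  (\esum_(t in setT) (p t)%:E)%E \is a fin_num.
Proof.
move=> p0; rewrite /abs_summable summableE.
by rewrite (@eq_esum _ _ _ _ (EFin \o p)) // => t _; rewrite gee0_abs ?lee_fin.
Qed.

Lemma abs_summableD f g :
  abs_summable f -> abs_summable g -> abs_summable (f \+ g).
Proof. exact: summableD. Qed.

Lemma abs_summableZ c f : abs_summable f -> abs_summable (fun t => c * f t).
Proof.
rewrite /abs_summable /summable => fs.
rewrite (@eq_esum _ _ _ _ (fun t => `|c|%:E * `|(f t)%:E|)%E); last first.
  by move=> t _; rewrite /= normrM.
by rewrite esumZl // lte_mul_pinfty ?lee_fin.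
Qed.

Definition tsum p := fine (\esum_(t in setT) (p t)%:E)%E.

Lemma tsumD p q : (forall t, 0 <= p t) -> (forall t, 0 <= q t) ->
  abs_summable p -> abs_summable q -> tsum (p \+ q) = tsum p + tsum q.
Proof.
move=> p0 q0 ps qs; rewrite /tsum -fineD ?abs_summable_fin // -esumD //.
- by move=> t _; rewrite lee_fin.
- by move=> t _; rewrite lee_fin.
Qed.

Lemma tsumZ c p : 0 <= c -> (forall t, 0 <= p t) -> abs_summable p ->
  tsum (fun t => c * p t) = c * tsum p.
Proof.
move=> c0 p0 ps; rewrite /tsum -[c in RHS]/(fine c%:E) -fineM //.
  by rewrite -esumZl.
exact: abs_summable_fin.
Qed.

(** The positive and negative parts that define [rsum] are not additive; that
    any splitting of f as a difference of nonnegative summable families gives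
    the same value is what makes [rsum] linear. *)
Lemma rsumE f p q : (forall t, f t = p t - q t) ->
  (forall t, 0 <= p t) -> (forall t, 0 <= q t) ->
  abs_summable p -> abs_summable q -> rsum f = tsum p - tsum q.
Proof.
move=> fE p0 q0 ps qs; rewrite /tsum -fineB ?abs_summable_fin //.
have {}fE : f = fun t => p t - q t by apply/funext.
rewrite -(esumB ps qs) => [|t _|t _]; rewrite ?lee_fin //.
have fs : abs_summable f by rewrite fE; have := summableB ps qs.
have posfin : (\esum_(t in setT) (EFin \o f)^\+%E t)%E \is a fin_num.
  have := summable_funepos fs; rewrite summableE.
  by rewrite (@eq_esum _ _ _ _ (EFin \o f)^\+%E) // => t _; rewrite gee0_abs.
have negfin : (\esum_(t in setT) (EFin \o f)^\-%E t)%E \is a fin_num.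
  have := summable_funeneg fs; rewrite summableE.
  by rewrite (@eq_esum _ _ _ _ (EFin \o f)^\-%E) // => t _; rewrite gee0_abs.
by rewrite /rsum -fineB // fE.
Qed.

Let pos f t := Num.max (f t) 0.
Let neg f t := Num.max (- f t) 0.

Let posB f t : f t = pos f t - neg f t.
Proof.
by rewrite /pos /neg; case: (leP (f t) 0) (leP (- f t) 0) => ? [] ?; lra.
Qed.

Let pos0 f t : 0 <= pos f t. Proof. by rewrite le_max lexx orbT. Qed.
Let neg0 f t : 0 <= neg f t. Proof. by rewrite le_max lexx orbT. Qed.

Let pos_summable f : abs_summable f -> abs_summable (pos f).
Proof.
move=> fs; apply: (@abs_summable_le _ (fun t => `|f t|)) => // t.
by rewrite ger0_norm // ge_max ler_norm normr_ge0.
Qed.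

Let neg_summable f : abs_summable f -> abs_summable (neg f).
Proof.
move=> fs; apply: (@abs_summable_le _ (fun t => `|f t|)) => // t.
by rewrite ger0_norm // ge_max -normrN ler_norm normr_ge0.
Qed.

Lemma rsum_ge0 p : (forall t, 0 <= p t) -> abs_summable p -> rsum p = tsum p.
Proof.
move=> p0 ps; rewrite (@rsumE _ p (fun=> 0)) //.
- by rewrite [tsum (fun=> 0)]/tsum esum1 // subr0.
- by move=> t; rewrite subr0.
- by apply: (@abs_summable_le _ p) => [t|]; rewrite ?normr0 //
     ltey_eq abs_summable_fin.
Qed.

Lemma rsumD f g : abs_summable f -> abs_summable g ->
  rsum (fun t => f t + g t) = rsum f + rsum g.
Proof.
move=> fs gs; have fp := pos_summable fs; have fn := neg_summable fs.
have gp := pos_summable gs; have gn := neg_summable gs.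
rewrite (@rsumE _ (pos f \+ pos g) (neg f \+ neg g)) /=.
- by rewrite !tsumD // (rsumE (posB f)) // (rsumE (posB g)) //; ring.
- by move=> t; rewrite {1}(posB f) {1}(posB g); ring.
- by move=> t; rewrite addr_ge0.
- by move=> t; rewrite addr_ge0.
- exact: abs_summableD.
- exact: abs_summableD.
Qed.

Lemma rsumZ c f : abs_summable f -> rsum (fun t => c * f t) = c * rsum f.
Proof.
move=> fs; have fp := pos_summable fs; have fn := neg_summable fs.
have [c0|c0] := leP 0 c.
  rewrite (@rsumE _ (fun t => c * pos f t) (fun t => c * neg f t)).
  - by rewrite !tsumZ // (rsumE (posB f)) // mulrBr.
  - by move=> t; rewrite -mulrBr -posB.
  - by move=> t; rewrite mulr_ge0.
  - by move=> t; rewrite mulr_ge0.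
  - exact: abs_summableZ.
  - exact: abs_summableZ.
have {c0}c0 : 0 <= - c by rewrite oppr_ge0 ltW.
rewrite (@rsumE _ (fun t => - c * neg f t) (fun t => - c * pos f t)).
- by rewrite !tsumZ // (rsumE (posB f)) //; ring.
- by move=> t; rewrite {1}(posB f); ring.
- by move=> t; rewrite mulr_ge0.
- by move=> t; rewrite mulr_ge0.
- exact: abs_summableZ.
- exact: abs_summableZ.
Qed.

End unconditional_sums.

(** * The inner product of l2(G) *)
Section inner_product.
Variables (R : realType) (G : groupType).
Local Notation H := (ell2 R G).
Implicit Types (x y z : H) (a c : R[i]).

Lemma normc_ge0 a : 0 <= normc a.
Proof. by case: a => p q; exact: sqrtr_ge0. Qed.

Lemma sqr_normcE a : normc a ^+ 2 = complex.Re a ^+ 2 + complex.Im a ^+ 2.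
Proof. by case: a => p q; rewrite sqr_sqrtr // addr_ge0 ?sqr_ge0. Qed.

Lemma Re_le_normc a : `|complex.Re a| <= normc a.
Proof.
rewrite -ler_sqr ?nnegrE ?normc_ge0 // sqr_normcE real_normK ?num_real //.
by rewrite lerDl sqr_ge0.
Qed.

Lemma Im_le_normc a : `|complex.Im a| <= normc a.
Proof.
rewrite -ler_sqr ?nnegrE ?normc_ge0 // sqr_normcE real_normK ?num_real //.
by rewrite lerDr sqr_ge0.
Qed.

Lemma ReC (r : R) : complex.Re r%:C = r. Proof. by []. Qed.

Lemma normcC (r : R) : normc r%:C = `|r|.
Proof. by rewrite /= expr0n addr0 sqrtr_sqr. Qed.

Lemma conjE a : a^* = conjc a. Proof. by []. Qed.

Lemma conjcC (r : R) : (r%:C)^* = r%:C.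
Proof. exact: conjc_real. Qed.

Lemma normcJ a : normc a^* = normc a.
Proof. by rewrite conjE; case: a => p q; rewrite /= sqrrN. Qed.

Lemma mulcJ a : a * a^* = (normc a ^+ 2)%:C.
Proof.
rewrite sqr_normcE conjE; case: a => p q /=; apply/eqP; rewrite eq_complex /=.
by apply/andP; split; apply/eqP; ring.
Qed.

Lemma ell2_eq x y : x =1 y -> x = y.
Proof. by move=> xy; apply: val_inj; apply/funext. Qed.

Lemma ell2D x y t : (x + y : H) t = x t + y t. Proof. by []. Qed.
Lemma ell2B x y t : (x - y : H) t = x t - y t. Proof. by []. Qed.
Lemma ell2Z a x t : (a *: x : H) t = a * x t. Proof. by []. Qed.
Lemma ell20 t : (0 : H) t = 0. Proof. by []. Qed.

Lemma sqr_summable x :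
  (\esum_(t in setT) (normc (x t) ^+ 2)%:E < +oo)%E.
Proof. exact/square_summableP/ell2P. Qed.

Lemma l2norm_ge0 x : 0 <= l2norm x. Proof. exact: sqrtr_ge0. Qed.

Lemma abs_summable_sqr x : abs_summable (fun t => normc (x t) ^+ 2).
Proof.
apply: abs_summable_le (sqr_summable x) => t.
by rewrite ger0_norm ?sqr_ge0.
Qed.

Lemma l2normE x :
  (l2norm x ^+ 2)%:E = (\esum_(t in setT) (normc (x t) ^+ 2)%:E)%E.
Proof.
have fin : (\esum_(t in setT) (normc (x t) ^+ 2)%:E)%E \is a fin_num.
  by apply: abs_summable_fin (abs_summable_sqr x) => t; exact: sqr_ge0.
rewrite sqr_sqrtr ?fineK // fine_ge0 // esum_ge0 // => t _.
by rewrite lee_fin sqr_ge0.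
Qed.

Lemma dot_summable x y :
  abs_summable (fun t => complex.Re (x t * (y t)^*)) /\
  abs_summable (fun t => complex.Im (x t * (y t)^*)).
Proof.
have xy : (\esum_(t in setT) (normc (x t) ^+ 2 + normc (y t) ^+ 2)%:E < +oo)%E.
  have := lte_add_pinfty (sqr_summable x) (sqr_summable y).
  by rewrite -esumD // => t _; rewrite lee_fin sqr_ge0.
have le t : normc (x t * (y t)^*) <= normc (x t) ^+ 2 + normc (y t) ^+ 2.
  rewrite normcM normcJ; have := sqr_ge0 (normc (x t) - normc (y t)).
  have : 0 <= normc (x t) * normc (y t) by rewrite mulr_ge0 ?normc_ge0.
  by rewrite sqrrB; nra.
split; apply: abs_summable_le xy => t; apply: le_trans (le t).
- exact: Re_le_normc.
- exact: Im_le_normc.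
Qed.

Lemma l2dotDl x y z : l2dot (x + y) z = l2dot x z + l2dot y z.
Proof.
have [xr xi] := dot_summable x z; have [yr yi] := dot_summable y z.
rewrite /l2dot /csum; apply/eqP; rewrite eq_complex /= -!rsumD //.
by apply/andP; split; apply/eqP; congr rsum; apply/funext => t;
  rewrite -raddfD -mulrDl.
Qed.

Lemma l2dotZl a x z : l2dot (a *: x) z = a * l2dot x z.
Proof.
have [xr xi] := dot_summable x z.
case: a => p q; rewrite /l2dot /csum; apply/eqP; rewrite eq_complex /=.
rewrite -mulNr -!rsumZ // -!rsumD; try exact: abs_summableZ.
by apply/andP; split; apply/eqP; congr rsum; apply/funext => t;
  rewrite -[(_ *: _) t]/((p +i* q) * x t) -mulrA;
  case: (x t * _) => u v /=; ring.
Qed.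

Lemma l2dotC x y : l2dot y x = (l2dot x y)^*.
Proof.
have [xr xi] := dot_summable x y.
rewrite /l2dot /csum; apply/eqP; rewrite eq_complex /=.
rewrite -mulN1r -rsumZ //; apply/andP; split; apply/eqP; congr rsum;
 by apply/funext => t; rewrite !conjE; case: (x t) (y t) => ? ? [? ?] /=; ring.
Qed.

Lemma l2dotxx x : l2dot x x = (l2norm x ^+ 2)%:C.
Proof.
rewrite /l2dot /csum; apply/eqP; rewrite eq_complex /=.
apply/andP; split; apply/eqP.
  have -> : (fun t => complex.Re (x t * (x t)^*)) = fun t => normc (x t) ^+ 2.
    by apply/funext => t; rewrite mulcJ.
  rewrite rsum_ge0; last exact: abs_summable_sqr.
    by rewrite /tsum -l2normE.
  by move=> t; exact: sqr_ge0.
have -> : (fun t => complex.Im (x t * (x t)^*)) = fun=> 0.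
  by apply/funext => t; rewrite mulcJ.
rewrite rsum_ge0 //; first by rewrite /tsum esum1.
by rewrite /abs_summable /summable esum1 // => t _; rewrite /= normr0.
Qed.

Lemma l2dotDr x y z : l2dot z (x + y) = l2dot z x + l2dot z y.
Proof. by rewrite l2dotC l2dotDl rmorphD /= -!l2dotC. Qed.

Lemma l2dotZr a x z : l2dot z (a *: x) = a^* * l2dot z x.
Proof. by rewrite l2dotC l2dotZl rmorphM /= -l2dotC. Qed.

Lemma l2dotNl x z : l2dot (- x) z = - l2dot x z.
Proof. by rewrite -scaleN1r l2dotZl mulN1r. Qed.

Lemma l2dotNr x z : l2dot z (- x) = - l2dot z x.
Proof. by rewrite l2dotC l2dotNl rmorphN /= -l2dotC. Qed.

Lemma l2dotBl x y z : l2dot (x - y) z = l2dot x z - l2dot y z.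
Proof. by rewrite l2dotDl l2dotNl. Qed.

Lemma l2dot0l z : l2dot 0 z = 0.
Proof. by rewrite -(scale0r (0 : H)) l2dotZl mul0r. Qed.

Lemma l2dot0r z : l2dot z 0 = 0.
Proof. by rewrite l2dotC l2dot0l conjC0. Qed.

Lemma normc_le_l2norm x t : normc (x t) <= l2norm x.
Proof.
rewrite -ler_sqr ?nnegrE ?normc_ge0 ?l2norm_ge0 // -lee_fin l2normE.
apply: esum_ge; exists [set t]; first by split.
by rewrite fsbig_set1.
Qed.

Lemma l2norm_eq0 x : l2norm x = 0 -> x = 0.
Proof.
move=> x0; apply: ell2_eq => t; apply: eq0_normc.
by apply/eqP; rewrite eq_le normc_ge0 -x0 normc_le_l2norm.
Qed.

Lemma l2normsq_eq0 x : l2dot x x = 0 -> x = 0.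
Proof.
by rewrite l2dotxx => -[] /eqP; rewrite sqrf_eq0 => /eqP; exact: l2norm_eq0.
Qed.

Lemma l2norm_sqr_re x : l2norm x ^+ 2 = complex.Re (l2dot x x).
Proof. by rewrite l2dotxx. Qed.

Lemma l2normZ a x : l2norm (a *: x) = normc a * l2norm x.
Proof.
apply/eqP.
rewrite -(@eqrXn2 _ 2) ?l2norm_ge0 ?mulr_ge0 ?normc_ge0 ?l2norm_ge0 //.
apply/eqP; rewrite l2norm_sqr_re l2dotZl l2dotZr mulrA mulcJ l2dotxx.
by rewrite -rmorphM ReC exprMn.
Qed.

Lemma l2norm0 : l2norm (0 : H) = 0.
Proof. by rewrite -(scale0r (0 : H)) l2normZ normc0 mul0r. Qed.

Lemma l2normN x : l2norm (- x) = l2norm x.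
Proof. by rewrite -scaleN1r l2normZ normcN normc1 mul1r. Qed.

Lemma l2distC x y : l2norm (x - y) = l2norm (y - x).
Proof. by rewrite -opprB l2normN. Qed.

Lemma l2norm_sqrD x y : l2norm (x + y) ^+ 2 =
  l2norm x ^+ 2 + l2norm y ^+ 2 + 2 * complex.Re (l2dot x y).
Proof.
rewrite !l2norm_sqr_re !l2dotDl !l2dotDr (l2dotC x y).
by rewrite !raddfD /=; case: (l2dot x y) => u v /=; ring.
Qed.

Lemma l2norm_sqrB x y : l2norm (x - y) ^+ 2 =
  l2norm x ^+ 2 + l2norm y ^+ 2 - 2 * complex.Re (l2dot x y).
Proof. by rewrite l2norm_sqrD l2normN l2dotNr raddfN /= mulrN. Qed.

Lemma CauchySchwarz x y : normc (l2dot x y) <= l2norm x * l2norm y.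
Proof.
have [y0|y0] := eqVneq (l2norm y) 0.
  by rewrite (l2norm_eq0 y0) l2dot0r normc0 mulr_ge0 ?l2norm_ge0.
have ny : 0 < l2norm y by rewrite lt0r y0 l2norm_ge0.
(* |y|^2 times the difference between x and its projection on the line through
   y: clearing the denominator avoids a division. *)
have := sqr_ge0 (l2norm ((l2norm y ^+ 2)%:C *: x - l2dot x y *: y)).
rewrite l2norm_sqrB !l2normZ l2dotZl l2dotZr (mulrC (_ ^*)) mulcJ -rmorphM.
rewrite ReC normcC ger0_norm ?sqr_ge0 //; move: ny (l2norm_ge0 x).
have := normc_ge0 (l2dot x y).
move: (normc _) (l2norm x) (l2norm y) => w u n w0 n0 u0 h.
rewrite -ler_sqr ?nnegrE ?mulr_ge0 ?(ltW n0) // exprMn.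
have : n ^+ 2 * w ^+ 2 <= n ^+ 2 * (u ^+ 2 * n ^+ 2) by nra.
by rewrite ler_pM2l ?exprn_gt0.
Qed.

Lemma l2normD x y : l2norm (x + y) <= l2norm x + l2norm y.
Proof.
rewrite -ler_sqr ?nnegrE ?addr_ge0 ?l2norm_ge0 // l2norm_sqrD sqrrD.
have := le_trans (ler_norm _) (le_trans (Re_le_normc _) (CauchySchwarz x y)).
by lra.
Qed.

Lemma l2normB_le x y z : l2norm (x - z) <= l2norm (x - y) + l2norm (y - z).
Proof. by apply: le_trans (l2normD _ _); rewrite addrA subrK. Qed.

Definition delta_fun (b t : G) : R[i] := (t == b)%:R.

Lemma delta_square_summable b : delta_fun b \in square_summable.
Proof.
apply/square_summableP; rewrite (esumID [set b]); last first.
  by move=> t _; rewrite lee_fin sqr_ge0.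
rewrite setTI esum_set1 ?lee_fin ?sqr_ge0 // esum1 ?adde0 ?ltry //.
by move=> t [_ /eqP tb]; rewrite /delta_fun (negPf tb) normc0 expr0n.
Qed.

Definition delta b : H := Ell2 (delta_square_summable b).

Lemma deltaE b t : delta b t = (t == b)%:R. Proof. by []. Qed.

Lemma l2norm_delta b : l2norm (delta b) = 1.
Proof.
apply/eqP; rewrite -(@eqrXn2 _ 2) ?l2norm_ge0 // expr1n -eqe l2normE.
rewrite (esumID [set b]); last by move=> t _; rewrite lee_fin sqr_ge0.
rewrite setTI esum_set1 ?lee_fin ?sqr_ge0 // deltaE eqxx normc1 expr1n.
rewrite esum1 ?adde0 // => t [_ /eqP tb].
by rewrite deltaE (negPf tb) normc0 expr0n.
Qed.

Lemma l2dot_delta x b : l2dot x (delta b) = x b.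
Proof.
have dot0 y : y b = 0 -> l2dot y (delta b) = 0.
  move=> yb; rewrite -(l2dot0l 0) /l2dot; congr csum; apply/funext => t.
  rewrite deltaE mul0r; have [->|_] := eqVneq t b; first by rewrite yb mul0r.
  by rewrite conjC0 mulr0.
rewrite -{1}(subrK (x b *: delta b) x) l2dotDl dot0 ?add0r.
  by rewrite l2dotZl l2dotxx l2norm_delta expr1n mulr1.
by rewrite ell2B ell2Z deltaE eqxx mulr1 subrr.
Qed.

Lemma l2dot_deltal x b : l2dot (delta b) x = (x b)^*.
Proof. by rewrite l2dotC l2dot_delta. Qed.

Lemma l2dot_inj x y : (forall z, l2dot x z = l2dot y z) -> x = y.
Proof.
by move=> xy; apply: ell2_eq => t; rewrite -!l2dot_delta xy.
Qed.

End inner_product.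
(** * Completeness of l2(G) *)
Section completeness.
Variables (R : realType) (G : groupType).
Local Notation H := (ell2 R G).
Implicit Types (x y z : H) (K : set H).

Lemma sum_sqr_le_l2norm x (s : seq G) : uniq s ->
  \sum_(t <- s) normc (x t) ^+ 2 <= l2norm x ^+ 2.
Proof.
move=> us; rewrite -lee_fin l2normE; apply: esum_ge.
exists [set` s]; first by split=> //; exact: finite_seq.
by rewrite -fsbig_seq // sumEFin.
Qed.

(** How limits are shown to lie in l2(G): it suffices to control finitely many
    coordinates at a time. *)
Lemma ell2_of_sums (w : G -> R[i]) (c : R) : 0 <= c ->
  (forall s : seq G, uniq s -> \sum_(t <- s) normc (w t) ^+ 2 <= c ^+ 2) ->
  exists2 x : H, x =1 w & l2norm x <= c.
Proof.
move=> c0 wc.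
have le : (\esum_(t in setT) (normc (w t) ^+ 2)%:E <= (c ^+ 2)%:E)%E.
  apply: ge_ereal_sup => _ [A [finA _] <-].
  rewrite fsbig_finite //= sumEFin lee_fin; exact/wc/finmap.fset_uniq.
have ws : w \in square_summable.
  apply/square_summableP; apply: le_lt_trans le _; exact: ltry.
exists (Ell2 ws) => //.
by rewrite -ler_sqr ?nnegrE ?l2norm_ge0 // -lee_fin l2normE.
Qed.

Definition vanishing (e : nat -> R) :=
  forall eps, 0 < eps -> exists N, forall n, (N <= n)%N -> e n < eps.

(** The explicit modulus e makes every a n - e n a lower bound of every
    a m + e m, so the limit is a supremum and no subsequence is extracted. *)
Lemma real_complete (a : nat -> R) (e : nat -> R) :
  (forall n m, (n <= m)%N -> `|a m - a n| <= e n) ->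
  exists l, forall n, `|l - a n| <= e n.
Proof.
move=> ae; pose E := range (fun n => a n - e n).
have Eub m : ubound E (a m + e m).
  move=> _ [n _ <-]; have e0 k : 0 <= e k.
    by apply: le_trans (ae k k (leqnn k)).
  have := e0 n; have := e0 m; case/orP: (leq_total n m) => /ae;
    by rewrite ler_norml => /andP[]; lra.
have E0 : E !=set0 by exists (a 0%N - e 0%N), 0%N.
exists (sup E) => n; rewrite ler_norml; apply/andP; split.
  suff : a n - e n <= sup E by lra.
  by apply: ub_le_sup; [exists (a 0%N + e 0%N); exact: Eub | exists n].
by have := ge_sup E0 (Eub n); lra.
Qed.

Lemma complex_complete (a : nat -> R[i]) (e : nat -> R) :
  (forall n m, (n <= m)%N -> normc (a m - a n) <= e n) ->
  exists l, forall n, normc (l - a n) <= 2 * e n.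
Proof.
move=> ae.
have [n m nm|p pP] := @real_complete (fun n => complex.Re (a n)) e.
  by rewrite -raddfB; apply: le_trans (Re_le_normc _) (ae _ _ nm).
have [n m nm|q qP] := @real_complete (fun n => complex.Im (a n)) e.
  by rewrite -raddfB; apply: le_trans (Im_le_normc _) (ae _ _ nm).
exists (p +i* q) => n.
have e0 : 0 <= e n by apply: le_trans (normc_ge0 _) (ae n n (leqnn n)).
rewrite -ler_sqr ?nnegrE ?normc_ge0 ?mulr_ge0 // sqr_normcE.
move: (pP n) (qP n); case: (a n) => u v /=.
rewrite -(ler_sqr (x := `|_|)) ?nnegrE // real_normK ?num_real // => h1.
rewrite -(ler_sqr (x := `|_|)) ?nnegrE // real_normK ?num_real // => h2.
by rewrite exprMn; have := sqr_ge0 (e n); lra.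
Qed.

(** The limit is taken coordinate by coordinate. On a fixed finite set of
    coordinates it differs from u m, for m large, by an amount as small as
    desired, so the bound e n survives there, and [ell2_of_sums] concludes. *)
Lemma ell2_complete (u : nat -> H) (e : nat -> R) : vanishing e ->
  (forall n m, (n <= m)%N -> l2norm (u m - u n) <= e n) ->
  exists x, forall n, l2norm (x - u n) <= e n.
Proof.
move=> ev ue.
have e0 n : 0 <= e n by apply: le_trans (l2norm_ge0 _) (ue n n (leqnn n)).
have /choice [w wP] : forall t, exists l, forall n,
    normc (l - u n t) <= 2 * e n.
  move=> t; apply: (@complex_complete (fun n => u n t) e) => n m nm.
  rewrite -[u m t - _]/((u m - u n : H) t).
  by have := le_trans (normc_le_l2norm (u m - u n) t) (ue _ _ nm).
have wu n : exists2 y : H, y =1 (fun t => w t - u n t) & l2norm y <= e n.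
  apply: ell2_of_sums => // s us; apply/ler_addgt0Pr => eps eps0.
  (* Each coordinate of the limit minus u n is at most 2 e n, that of u m - u n
     at most e n, and they differ by at most 2 e m: the squares differ by at
     most (2 e m) (3 e n). *)
  pose c := (size s)%:R * (6 * e n) + 1.
  have c0 : 0 < c by rewrite ltr_pwDr // !mulr_ge0.
  have [N NP] := ev (eps / c) (divr_gt0 eps0 c0).
  pose m := maxn N n; have nm : (n <= m)%N by exact: leq_maxr.
  have em : e m * c <= eps by rewrite -ler_pdivlMr // ltW // NP // leq_maxl.
  apply: (@le_trans _ _
      (\sum_(t <- s) (normc ((u m - u n : H) t) ^+ 2 + 6 * e n * e m))).
    apply: ler_sum => t _.
    have h1 : normc (w t - u n t) <= 2 * e n by exact: wP.
    have h2 : normc ((u m - u n : H) t) <= e n.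
      exact: le_trans (normc_le_l2norm _ _) (ue _ _ nm).
    have h3 : normc (w t - u n t) <= normc ((u m - u n : H) t) + 2 * e m.
      have -> : w t - u n t = (u m - u n : H) t + (w t - u m t).
        by rewrite ell2B; ring.
      by apply: le_trans (le_normcD _ _) _; rewrite lerD2l.
    move: h1 h2 h3 (e0 n) (e0 m) (normc_ge0 (w t - u n t)).
    move: (normc_ge0 ((u m - u n : H) t)).
    move: (normc _) (normc _) (e n) (e m) => p q a b; nra.
  rewrite big_split; apply: lerD.
    apply: le_trans (sum_sqr_le_l2norm (u m - u n) us) _.
    by rewrite ler_sqr ?nnegrE ?l2norm_ge0 // ue.
  apply: le_trans em.
  rewrite big_const_seq count_predT iter_addr addr0 -mulr_natl /c.
  by have := e0 m; lra.
have [y0 y0E _] := wu 0%N; exists (y0 + u 0%N) => n.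
have [y yE] := wu n; congr (_ <= _); congr l2norm; apply: ell2_eq => t.
by rewrite yE ell2B ell2D y0E; ring.
Qed.

End completeness.
(** * Orthogonal projection and adjoints *)
Section projection.
Variables (R : realType) (G : groupType).
Local Notation H := (ell2 R G).
Implicit Types (x y z k p : H) (K : set H) (T S : H -> H).

Record closed_subspace K : Prop := ClosedSubspace {
  subspace0 : K 0;
  subspaceP : forall (a : R[i]) x y, K x -> K y -> K (a *: x + y);
  subspace_closed : forall x,
    (forall eps, 0 < eps -> exists2 y, K y & l2norm (x - y) <= eps) -> K x }.

Lemma parallelogram x y :
  l2norm (x + y) ^+ 2 + l2norm (x - y) ^+ 2 =
  2 * l2norm x ^+ 2 + 2 * l2norm y ^+ 2.
Proof. by rewrite l2norm_sqrD l2norm_sqrB; ring. Qed.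

Lemma vanishing_inv : vanishing (fun n => n.+1%:R^-1 : R).
Proof.
move=> eps /ltr_add_invr[N]; rewrite add0r => Ne; exists N => n Nn.
by apply: le_lt_trans Ne; rewrite lef_pV2 ?posrE ?ltr0n // ler_nat.
Qed.

(** A minimizing sequence is Cauchy by the parallelogram law, because the
    midpoint of two of its terms is again in K and so not closer to x than the
    infimum D. *)
Lemma nearest_point K x : closed_subspace K ->
  exists2 p, K p & forall k, K k -> l2norm (x - p) <= l2norm (x - k).
Proof.
move=> Ksub; pose E := [set r | exists2 k, K k & r = l2norm (x - k)].
have Einf : has_inf E.
  split; first by exists (l2norm (x - 0)), 0 => //; exact: subspace0.
  by exists 0 => _ [k _ ->]; exact: l2norm_ge0.
pose D := inf E.
have DE k : K k -> D <= l2norm (x - k).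
  by move=> Kk; apply: ge_inf; [case: Einf | exists k].
have D0 : 0 <= D.
  apply: lb_le_inf; first by case: Einf.
  by move=> _ [k _ ->]; exact: l2norm_ge0.
pose h n : R := n.+1%:R^-1.
have h0 n : 0 < h n by rewrite invr_gt0 ltr0n.
have h1 n : h n <= 1 by rewrite invf_le1 ?ltr0n // ler1n.
have hle n m : (n <= m)%N -> h m <= h n.
  by move=> nm; rewrite lef_pV2 ?posrE ?ltr0n // ler_nat.
have /choice[u uP] : forall n, exists k, K k /\ l2norm (x - k) < D + h n.
  by move=> n; have [_ [k Kk ->] kD] := inf_adherent (h0 n) Einf; exists k.
(* 2 (D + h m)^2 + 2 (D + h n)^2 - 4 D^2 <= (8 D + 4) h n for n <= m. *)
pose e n := Num.sqrt ((8 * D + 4) * h n).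
have e2 n : e n ^+ 2 = (8 * D + 4) * h n.
  by rewrite sqr_sqrtr // mulr_ge0 ?(ltW (h0 n)) // addr_ge0 ?mulr_ge0.
have e0 n : 0 <= e n by exact: sqrtr_ge0.
have ev : vanishing e.
  move=> eps eps0; have c0 : 0 < 8 * D + 4 by lra.
  have [N NP] := vanishing_inv (divr_gt0 (exprn_gt0 2 eps0) c0).
  exists N => n /NP; rewrite ltr_pdivlMr // mulrC => ne.
  by rewrite -ltr_sqr ?nnegrE ?(ltW eps0) // e2.
have [p pP] : exists p, forall n, l2norm (p - u n) <= e n.
  apply: ell2_complete => // n m nm.
  have [Km um] := uP m; have [Kn un] := uP n.
  rewrite -ler_sqr ?nnegrE ?l2norm_ge0 // e2.
  have := parallelogram (x - u n) (x - u m).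
  have -> : x - u n - (x - u m) = u m - u n.
    by rewrite opprB addrC addrA subrK.
  have -> : x - u n + (x - u m) = 2 *: (x - (2^-1 *: u n + 2^-1 *: u m)).
    rewrite scalerBr scalerDr !scalerA mulfV ?pnatr_eq0 // !scale1r.
    by rewrite addrACA -opprD scaler_nat mulr2n.
  have : D <= l2norm (x - (2^-1 *: u n + 2^-1 *: u m)).
    apply: DE; apply: subspaceP => //.
    by rewrite -[_ *: _]addr0; apply: subspaceP => //; exact: subspace0.
  rewrite l2normZ (_ : normc 2 = 2); last first.
    by rewrite -[2 : R[i]](rmorph_nat (real_complex R)) normcC ger0_norm.
  move: um un (h1 n) (h0 m) (h0 n) (hle _ _ nm).
  move: (l2norm_ge0 (x - u m)) (l2norm_ge0 (x - u n)).
  set c := l2norm (x - (_ + _)).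
  move: (l2norm (x - u m)) (l2norm (x - u n)) (l2norm (u m - u n)) c.
  move: (h n) (h m) => hn hm a b w c; move=> a0 b0 aD bD hn1 hm0 hn0 hmn Dc.
  have a2 : a ^+ 2 <= (D + hn) ^+ 2 by nra.
  have b2 : b ^+ 2 <= (D + hn) ^+ 2 by nra.
  have c2 : D ^+ 2 <= c ^+ 2 by nra.
  by rewrite exprMn; nra.
have Kp : K p.
  apply: (subspace_closed Ksub) => eps /ev[N /(_ _ (leqnn N)) eN].
  by exists (u N); [case: (uP N) | exact: le_trans (ltW eN)].
exists p => // k /DE; apply: le_trans; apply/ler_addgt0Pr => eps eps0.
have eps20 : 0 < eps / 2 by rewrite divr_gt0.
have [N NP] := ev _ eps20; have [M MP] := vanishing_inv eps20.
set n := maxn N M; apply: le_trans (l2normB_le _ (u n) _) _.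
have := NP n (leq_maxl _ _); have := MP n (leq_maxr _ _).
have [_] := uP n; have := pP n; rewrite (l2distC p).
by move: (l2norm _) (l2norm _) (e n) => a b c; rewrite -/(h n); lra.
Qed.

(** Moving from the nearest point p in the direction c k, with c = <x - p, k>,
    decreases the distance to first order unless c = 0. *)
Lemma projectionP K x : closed_subspace K ->
  exists2 p, K p & forall k, K k -> l2dot (x - p) k = 0.
Proof.
move=> Ksub; have [p Kp pmin] := nearest_point x Ksub.
exists p => // k Kk; set c := l2dot (x - p) k.
(* A step short enough for the quadratic term s^2 |c|^2 |k|^2 not to make up
   for the linear gain 2 s |c|^2, also when k = 0. *)
pose s : R := (l2norm k ^+ 2 + 1)^-1.
have n1 : 0 < l2norm k ^+ 2 + 1 by rewrite ltr_pwDr ?sqr_ge0.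
have s0 : 0 < s by rewrite invr_gt0.
have := pmin _ (subspaceP Ksub (s%:C * c) Kk Kp).
have -> : x - (s%:C * c *: k + p) = (x - p) - s%:C * c *: k.
  by rewrite opprD addrCA addrC.
rewrite -ler_sqr ?nnegrE ?l2norm_ge0 // [leRHS]l2norm_sqrB.
rewrite l2dotZr -/c.
have -> : (s%:C * c)^* * c = (s * normc c ^+ 2)%:C.
  by rewrite rmorphM /= conjcC -mulrA (mulrC (c^*)) mulcJ -rmorphM.
rewrite l2normZ normcM normcC gtr0_norm // ReC.
have sn : s * (l2norm k ^+ 2 + 1) = 1 by rewrite mulVf ?gt_eqF.
move: (normc_ge0 c) => c0 h; apply: eq0_normc; apply/eqP; rewrite -sqrf_eq0.
rewrite eq_le sqr_ge0 andbT -(pmulr_rle0 _ s0).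
have : s * normc c ^+ 2 * (s * (l2norm k ^+ 2 + 1)) = s * normc c ^+ 2.
  by rewrite sn mulr1.
have : 0 <= s ^+ 2 * normc c ^+ 2 by rewrite mulr_ge0 ?sqr_ge0.
by move: h; rewrite !exprMn; lra.
Qed.

Section linear_maps.
Variable V : lmodType R[i].
Variable T : H -> V.
Hypothesis linT : linear T.

Lemma lin0 : T 0 = 0.
Proof. by have := linT (-1) 0 0; rewrite !scaleN1r !addNr. Qed.

Lemma linZ (a : R[i]) x : T (a *: x) = a *: T x.
Proof. by have := linT a x 0; rewrite !addr0 lin0 addr0. Qed.

Lemma linD x y : T (x + y) = T x + T y.
Proof. by have := linT 1 x y; rewrite !scale1r. Qed.

Lemma linN x : T (- x) = - T x.
Proof. by rewrite -[- x]scaleN1r linZ scaleN1r. Qed.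

Lemma linB x y : T (x - y) = T x - T y.
Proof. by rewrite linD linN. Qed.

End linear_maps.

Lemma bounded_norm T : bounded_operator T ->
  exists2 c : R, 0 < c & forall x, l2norm (T x) <= c * l2norm x.
Proof.
move=> [_ [c cP]]; exists (`|c| + 1) => [|x].
  by rewrite ltr_pwDr.
apply: le_trans (cP x) _; rewrite ler_wpM2r ?l2norm_ge0 //.
by have := ler_norm c; lra.
Qed.

Lemma kernel_closed_subspace (F : set (H -> H)) :
  F `<=` @bounded_operator R G ->
  closed_subspace [set x | forall T, F T -> T x = 0].
Proof.
move=> Fb; split=> [T|a x y x0 y0 T|x xK T] /=.
- by move=> /Fb [linT _]; rewrite lin0.
- move=> FT; have [linT _] := Fb _ FT.
  by rewrite linT x0 // y0 // scaler0 add0r.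
move=> FT; have [linT _] := Fb _ FT; have [c c0 cP] := bounded_norm (Fb _ FT).
apply: l2norm_eq0; apply/eqP; rewrite eq_le l2norm_ge0 andbT.
apply/ler_addgt0Pr => eps eps0; rewrite add0r.
have [y /(_ T FT) Ty xy] := xK _ (divr_gt0 eps0 c0).
have := cP (x - y); rewrite linB // Ty subr0 => /le_trans; apply.
by rewrite mulrC -ler_pdivlMr.
Qed.

(** The representing vector spans the orthogonal complement of the kernel of
    phi, which is a line unless phi = 0. *)
Lemma riesz (phi : H -> R[i]) (c : R) :
  (forall a x y, phi (a *: x + y) = a * phi x + phi y) ->
  (forall x, normc (phi x) <= c * l2norm x) ->
  exists v, forall x, phi x = l2dot x v.
Proof.
move=> linphi phic.
have phi0 : phi 0 = 0.
  by have := linphi (-1) 0 0; rewrite scaleN1r mulN1r !addNr.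
have phiB x y : phi (x - y) = phi x - phi y.
  have := linphi (-1) y x; rewrite scaleN1r mulN1r addrC => ->.
  by rewrite addrC.
have phiZ a x : phi (a *: x) = a * phi x.
  by have := linphi a x 0; rewrite phi0 !addr0.
have Ksub : closed_subspace [set x | phi x = 0].
  split=> [//|a x y x0 y0|x xK] /=; first by rewrite linphi x0 y0 mulr0 addr0.
  apply: eq0_normc; apply/eqP; rewrite eq_le normc_ge0 andbT.
  apply/ler_addgt0Pr => eps eps0; rewrite add0r.
  have c0 : 0 < `|c| + 1 by rewrite ltr_pwDr.
  have [y /= y0 xy] := xK _ (divr_gt0 eps0 c0).
  have := phic (x - y); rewrite phiB y0 subr0 => /le_trans; apply.
  apply: (@le_trans _ _ ((`|c| + 1) * l2norm (x - y))).
    by rewrite ler_wpM2r ?l2norm_ge0 //; have := ler_norm c; lra.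
  by rewrite mulrC -ler_pdivlMr.
have [phi_eq0|/existsNP[x0 /eqP phix0]] := pselect (forall x, phi x = 0).
  by exists 0 => x; rewrite phi_eq0 l2dot0r.
have [p /= phip orth] := projectionP x0 Ksub.
set w := x0 - p in orth; have phiw : phi w = phi x0 by rewrite phiB phip subr0.
have ww : l2dot w w != 0.
  apply: contra_neq phix0 => /l2normsq_eq0 w0.
  by rewrite -phiw w0.
exists ((phi w / l2dot w w)^* *: w) => x.
rewrite l2dotZr conjCK.
have : l2dot (phi w *: x - phi x *: w) w = 0.
  by rewrite l2dotC orth ?conjC0 //= phiB !phiZ mulrC subrr.
rewrite l2dotBl !l2dotZl => /eqP; rewrite subr_eq0 => /eqP h.
by rewrite mulrAC h mulfK.
Qed.

Lemma adjoint_exists T : bounded_operator T -> exists S, adjoint_of T S.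
Proof.
move=> [linT [c cP]].
have /choice[S SP] : forall y, exists v, forall x, l2dot (T x) y = l2dot x v.
  move=> y; apply: (@riesz _ (c * l2norm y)) => [a x z|x].
    by rewrite linT l2dotDl l2dotZl.
  apply: le_trans (CauchySchwarz _ _) _.
  by rewrite mulrAC ler_wpM2r ?l2norm_ge0.
by exists S => x y.
Qed.

Lemma adjoint_sym T S : adjoint_of T S -> adjoint_of S T.
Proof. by move=> TS x y; rewrite l2dotC -TS -l2dotC. Qed.

Lemma adjoint_linear T S : adjoint_of T S -> linear S.
Proof.
move=> /adjoint_sym TS a x y; apply: l2dot_inj => z.
by rewrite TS !l2dotDl !l2dotZl !TS.
Qed.

Lemma adjoint_le T S (c : R) : 0 <= c -> adjoint_of T S ->
  (forall x, l2norm (T x) <= c * l2norm x) ->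
  forall x, l2norm (S x) <= c * l2norm x.
Proof.
move=> c0 TS cP x; have [S0|S0] := eqVneq (l2norm (S x)) 0.
  by rewrite S0 mulr_ge0 ?l2norm_ge0.
have Sgt : 0 < l2norm (S x) by rewrite lt0r S0 l2norm_ge0.
rewrite -(ler_pM2r Sgt) -expr2 l2norm_sqr_re -TS.
apply: le_trans (le_trans (ler_norm _) (Re_le_normc _)) _.
apply: le_trans (CauchySchwarz _ _) _.
by rewrite mulrAC ler_wpM2r ?l2norm_ge0.
Qed.

Lemma adjoint_bounded T S :
  bounded_operator T -> adjoint_of T S -> bounded_operator S.
Proof.
move=> Tb TS; split; first exact: adjoint_linear TS.
by have [c c0 /(adjoint_le (ltW c0) TS)] := bounded_norm Tb; exists c.
Qed.

Lemma adjoint_unique T S S' : adjoint_of T S -> adjoint_of T S' -> S = S'.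
Proof.
move=> TS TS'; apply/funext => x; apply: l2dot_inj => z.
by rewrite l2dotC -TS TS' -l2dotC.
Qed.

Lemma adjointM T S T' S' :
  adjoint_of T T' -> adjoint_of S S' -> adjoint_of (T \o S) (S' \o T').
Proof. by move=> TT SS x y /=; rewrite TT SS. Qed.

(** The vectors T (delta b) determine the adjoint of T coordinate by coordinate;
    going through the adjoint replaces the density of finitely supported
    vectors. *)
Lemma operator_ext T S : bounded_operator T -> bounded_operator S ->
  (forall b, T (delta R b) = S (delta R b)) -> T = S.
Proof.
move=> /adjoint_exists[T' TT] /adjoint_exists[S' SS] TS.
suff TS' : T' = S'.
  by apply: adjoint_unique (adjoint_sym TT) _; rewrite TS'; exact: adjoint_sym.
apply/funext => x; apply: ell2_eq => t; apply: (can_inj conjCK).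
by rewrite -!l2dot_deltal -TT -SS TS.
Qed.

End projection.
(** * Operator algebras and commutants *)
Section operator_algebras.
Variables (R : realType) (G : groupType).
Local Notation H := (ell2 R G).
Local Notation bounded := (@bounded_operator R G).
Implicit Types (x y z : H) (T S : H -> H) (A M X : set (H -> H)).

Lemma commP T S : T \o S = S \o T <-> forall x, T (S x) = S (T x).
Proof. by split=> [TS x|TS]; [have := congr1 (@^~ x) TS | apply/funext]. Qed.

Lemma bounded0 : bounded 0.
Proof.
split=> [a x y|]; first by rewrite [RHS]addr0 [RHS]scaler0.
by exists 0 => x; rewrite mul0r (_ : (0 : H -> H) x = 0) // l2norm0.
Qed.

Lemma bounded_id : bounded id.
Proof. by split=> //; exists 1 => x; rewrite mul1r. Qed.

Lemma boundedD T S : bounded T -> bounded S -> bounded (T + S).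
Proof.
move=> [lT [c cP]] [lS [d dP]]; split=> [a x y|].
  by rewrite -![(_ + _) _]/(T _ + S _) lT lS scalerDr addrACA.
exists (c + d) => x; rewrite -![(_ + _) _]/(T _ + S _) mulrDl.
exact: le_trans (l2normD _ _) (lerD _ _).
Qed.

Lemma boundedZ (a : R[i]) T : bounded T -> bounded (a *: T).
Proof.
move=> [lT [c cP]]; split=> [b x y|].
  by rewrite -![(_ *: _) _]/(a *: T _) lT scalerDr !scalerA mulrC.
exists (normc a * c) => x; rewrite -[(_ *: _) _]/(a *: T _) l2normZ -mulrA.
by rewrite ler_wpM2l ?normc_ge0.
Qed.

Lemma boundedM T S : bounded T -> bounded S -> bounded (T \o S).
Proof.
move=> Tb [lS [d dP]]; have [lT _] := Tb; have [c c0 cP] := bounded_norm Tb.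
split=> [a x y /=|]; first by rewrite lS lT.
exists (c * d) => x; apply: le_trans (cP _) _.
by rewrite -mulrA ler_wpM2l ?(ltW c0).
Qed.

Definition commutant X : set (H -> H) :=
  [set T | bounded T /\ forall S, X S -> T \o S = S \o T].

Definition star_stable X := forall S, X S -> exists2 S', X S' & adjoint_of S S'.

(** The source of all upper bounds on the generated algebras: an operator
    commuting with the generators and their adjoints commutes with the von
    Neumann algebra that they generate. *)
Lemma commutant_von_neumann X : X `<=` bounded -> star_stable X ->
  von_neumann_algebra (commutant X).
Proof.
move=> Xb Xstar; split.
- split=> [T [] //||T S [Tb TX] [Sb SX]|a T [Tb TX]|T S [Tb TX] [Sb SX]|T T'].
  + split=> [|S XS]; first exact: bounded0.
    by have [lS _] := Xb _ XS; apply/commP => x; rewrite -[LHS]/(0 : H) lin0.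
  + split=> [|U XU]; first exact: boundedD.
    have [lU _] := Xb _ XU; apply/commP => x.
    move: (TX _ XU) (SX _ XU) => /commP TU /commP SU.
    by rewrite -![(_ + _) _]/(T _ + S _) TU SU linD.
  + split=> [|U XU]; first exact: boundedZ.
    have [lU _] := Xb _ XU; apply/commP => x; move: (TX _ XU) => /commP TU.
    by rewrite -![(_ *: _) _]/(a *: T _) TU linZ.
  + split=> [|U XU]; first exact: boundedM.
    move: (TX _ XU) (SX _ XU) => /commP TU /commP SU; apply/commP => x /=.
    by rewrite SU TU.
  + move=> [Tb TX] TT'; split=> [|S XS]; first exact: adjoint_bounded TT'.
    have [S' XS' SS'] := Xstar _ XS.
    apply/esym/(adjoint_unique (adjointM TT' (adjoint_sym SS'))).
    by rewrite TX //; apply: adjointM TT'; exact: adjoint_sym.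
- by split=> // ; exact: bounded_id.
- move=> T Tb Tapp; split=> // S XS; apply/commP => x.
  have [S' XS' SS'] := Xstar _ XS.
  apply: l2dot_inj => y; apply/eqP; rewrite -subr_eq0; apply/eqP.
  apply: eq0_normc; apply/eqP; rewrite eq_le normc_ge0 andbT.
  apply/ler_addgt0Pr => eps eps0; rewrite add0r.
  have eps20 : 0 < eps / 2 by rewrite divr_gt0.
  have [B [_ BX] BP] := Tapp _ [:: (S x, y); (x, S' y)] eps20.
  have B1 : normc (l2dot (T (S x) - B (S x)) y) < eps / 2.
    by apply: (BP (S x, y)); exact: mem_head.
  have B2 : normc (l2dot (T x - B x) (S' y)) < eps / 2.
    by apply: (BP (x, S' y)); rewrite inE mem_head orbT.
  have -> : l2dot (T (S x)) y - l2dot (S (T x)) y =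
            l2dot (T (S x) - B (S x)) y - l2dot (T x - B x) (S' y).
    move: (BX _ XS) => /commP BS.
    by rewrite !l2dotBl BS -!SS'; ring.
  by apply: le_trans (le_normcD _ _) _; rewrite normcN; lra.
Qed.

Lemma wot_norm_closed A : A `<=` bounded -> wot_closed A -> norm_closed A.
Proof.
move=> Ab Aw T Tb Tapp; apply: Aw => // eps s eps0.
pose c : R := \sum_(p <- s) l2norm p.1 * l2norm p.2.
have c0 : 0 <= c by apply: sumr_ge0 => p _; rewrite mulr_ge0 ?l2norm_ge0.
have c1 : 0 < c + 1 by rewrite ltr_pwDr.
have [S AS SP] := Tapp _ (divr_gt0 eps0 c1).
exists S => // p ps; apply: le_lt_trans (CauchySchwarz _ _) _.
apply: (@le_lt_trans _ _ (eps / (c + 1) * c)).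
  apply: (@le_trans _ _ (eps / (c + 1) * (l2norm p.1 * l2norm p.2))).
    by rewrite mulrA ler_wpM2r ?l2norm_ge0.
  rewrite ler_wpM2l ?divr_ge0 ?(ltW eps0) ?(ltW c1) // /c (big_rem p) //=.
  by rewrite lerDl sumr_ge0 // => q _; rewrite mulr_ge0 ?l2norm_ge0.
rewrite mulrAC ltr_pdivrMr // ltr_pM2l //; lra.
Qed.

Lemma von_neumann_cstar M : von_neumann_algebra M -> cstar_algebra M.
Proof.
move=> [Mstar _ Mw]; split=> //; apply: wot_norm_closed => //.
exact: star_bounded.
Qed.

(** Makes the families intersected by [smallest] nonempty, so that a generated
    algebra consists of bounded operators. *)
Lemma bounded_von_neumann : von_neumann_algebra bounded.
Proof.
have -> : bounded = commutant set0.
  by apply/seteqP; split=> [T Tb|T []].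
exact: commutant_von_neumann.
Qed.

Lemma star_subalgebra_bigcap (F : set (set (H -> H))) :
  (forall A, F A -> star_subalgebra A) -> F !=set0 ->
  star_subalgebra (\bigcap_(A in F) A).
Proof.
move=> Fs [A0 FA0]; split.
- by move=> T TF; apply: (star_bounded (Fs _ FA0)); exact: TF.
- by move=> A FA; exact: star0 (Fs _ FA).
- by move=> S T SF TF A FA; apply: (starD (Fs _ FA)); [exact: SF | exact: TF].
- by move=> a T TF A FA; apply: (starZ (Fs _ FA)); exact: TF.
- by move=> S T SF TF A FA; apply: (starM (Fs _ FA)); [exact: SF | exact: TF].
- by move=> T S TF TS A FA; apply: (star_adjoint (Fs _ FA)) TS; exact: TF.
Qed.

Lemma cstar_bigcap (F : set (set (H -> H))) :
  (forall A, F A -> cstar_algebra A) -> F !=set0 ->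
  cstar_algebra (\bigcap_(A in F) A).
Proof.
move=> Fs F0; split; first by apply: star_subalgebra_bigcap => // A /Fs [].
move=> T Tb Tapp A FA; have [_ An] := Fs _ FA; apply: An => // eps /Tapp[S SF].
by exists S => //; exact: SF.
Qed.

Lemma von_neumann_bigcap (F : set (set (H -> H))) :
  (forall A, F A -> von_neumann_algebra A) -> F !=set0 ->
  von_neumann_algebra (\bigcap_(A in F) A).
Proof.
move=> Fs F0; split; first by apply: star_subalgebra_bigcap => // A /Fs [].
  by move=> A /Fs [].
move=> T Tb Tapp A FA; have [_ _ An] := Fs _ FA.
by apply: An => // eps s /(Tapp _ s)[S SF]; exists S => //; exact: SF.
Qed.

Lemma smallest_cstar X : X `<=` bounded ->
  cstar_algebra (smallest (@cstar_algebra R G) X).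
Proof.
move=> Xb; apply: cstar_bigcap => [A []//|].
by exists bounded; split=> //; exact/von_neumann_cstar/bounded_von_neumann.
Qed.

Lemma smallest_von_neumann X : X `<=` bounded ->
  von_neumann_algebra (smallest (@von_neumann_algebra R G) X).
Proof.
move=> Xb; apply: von_neumann_bigcap => [A []//|].
by exists bounded; split=> //; exact: bounded_von_neumann.
Qed.

Lemma star_subalgebra_stable A : star_subalgebra A -> star_stable A.
Proof.
move=> As T AT; have [T' TT'] := adjoint_exists (star_bounded As AT).
by exists T' => //; exact: star_adjoint TT'.
Qed.

(** The center of A is the intersection of A with its commutant. *)
Lemma center_cstar A : cstar_algebra A -> cstar_algebra (algebra_center A).
Proof.
move=> Acs; have [As _] := Acs.
have -> : algebra_center A =
    \bigcap_(B in [set B | B = A \/ B = commutant A]) B.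
  apply/seteqP; split=> [T [AT TA] B [->|->] //|T TI].
    by split=> //; exact: star_bounded AT.
  split; first by apply: TI; left.
  by have [] : commutant A T by apply: TI; right.
apply: cstar_bigcap; last by exists A; left.
move=> B [->//|->]; apply/von_neumann_cstar/commutant_von_neumann.
  exact: star_bounded.
exact: star_subalgebra_stable.
Qed.

End operator_algebras.
(** * Left and right twisted translations *)
Section translations.
Variables (R : realType) (G : groupType) (sigma : multiplier R G).
Local Notation H := (ell2 R G).
Local Notation lam := (lambda sigma).
Local Notation dlt := (@delta R G).
Implicit Types (a b c : G) (x y : H) (T S : H -> H).

Lemma normc_mult a b : normc (sigma a b) = 1.
Proof.
have normcT z : `|z| = 1 -> normc z = 1 :> R.
  by rewrite normc_def => -[]; case: z.
exact/normcT/multT.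
Qed.

Lemma mult_conj a b : sigma a b * (sigma a b)^* = 1.
Proof. by rewrite mulcJ normc_mult expr1n. Qed.

Lemma mult_neq0 a b : sigma a b != 0.
Proof.
by apply: contra_eq_neq (mult_conj a b) => ->; rewrite mul0r eq_sym oner_eq0.
Qed.

(** Right translation twisted by sigma: delta a goes to sigma(a,b) delta(ab).
    The cocycle identity says exactly that it commutes with every lambda. *)
Definition rho_fun b (x : G -> R[i]) (c : G) : R[i] :=
  sigma (c * b^-1)%g b * x (c * b^-1)%g.

Lemma esum_twist (f : G -> G) (u : G -> R[i]) x : bijective f ->
  (forall c, normc (u c) = 1) ->
  (\esum_(c in setT) (normc (u c * x (f c)) ^+ 2)%:E = (l2norm x ^+ 2)%:E)%E.
Proof.
move=> [g fK gK] u1; rewrite l2normE.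
rewrite [RHS](@reindex_esum _ _ _ setT setT f) //; last first.
  by split=> // [c d _ _ /(can_inj fK)|c _] //; exists (g c).
by apply: eq_esum => c _; rewrite normcM u1 mul1r.
Qed.

Lemma rho_square_summable b x : rho_fun b x \in square_summable.
Proof.
apply/square_summableP.
rewrite (@esum_twist (fun c => c * b^-1)%g
                     (fun c => sigma (c * b^-1)%g b) x).
- exact: ltry.
- by exists (fun c => c * b)%g => c; rewrite ?mulgVK ?mulgK.
- by move=> c; exact: normc_mult.
Qed.

Definition rho b x : H := Ell2 (rho_square_summable b x).

Lemma lambdaE a x c : lam a x c = sigma a (a^-1 * c)%g * x (a^-1 * c)%g.
Proof. by []. Qed.

Lemma rhoE b x c : rho b x c = sigma (c * b^-1)%g b * x (c * b^-1)%g.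
Proof. by []. Qed.

Lemma lambda_bounded a : bounded_operator (lam a).
Proof.
split=> [k x y|].
  by apply: ell2_eq => c; rewrite lambdaE !ell2D !ell2Z !lambdaE mulrDr mulrCA.
exists 1 => x; rewrite mul1r -ler_sqr ?nnegrE ?l2norm_ge0 // -lee_fin l2normE.
rewrite (@esum_twist (fun c => a^-1 * c)%g
                     (fun c => sigma a (a^-1 * c)%g) x) //.
- by exists (fun c => a * c)%g => c; rewrite ?mulVKg ?mulKg.
- by move=> c; exact: normc_mult.
Qed.

Lemma rho_bounded b : bounded_operator (rho b).
Proof.
split=> [k x y|].
  by apply: ell2_eq => c; rewrite rhoE !ell2D !ell2Z !rhoE mulrDr mulrCA.
exists 1 => x; rewrite mul1r -ler_sqr ?nnegrE ?l2norm_ge0 // -lee_fin l2normE.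
rewrite (@esum_twist (fun c => c * b^-1)%g
                     (fun c => sigma (c * b^-1)%g b) x) //.
- by exists (fun c => c * b)%g => c; rewrite ?mulgVK ?mulgK.
- by move=> c; exact: normc_mult.
Qed.

Lemma lambda_delta a b : lam a (dlt b) = sigma a b *: dlt (a * b)%g.
Proof.
apply: ell2_eq => c; rewrite lambdaE ell2Z !deltaE.
have [<-|ne] := eqVneq (a^-1 * c)%g b; first by rewrite mulVKg eqxx.
rewrite !mulr0; have [cab|] := eqVneq c (a * b)%g; last by rewrite mulr0.
by rewrite cab mulKg eqxx in ne.
Qed.

Lemma rho_delta a b : rho b (dlt a) = sigma a b *: dlt (a * b)%g.
Proof.
apply: ell2_eq => c; rewrite rhoE ell2Z !deltaE.
have [<-|ne] := eqVneq (c * b^-1)%g a; first by rewrite mulgVK eqxx.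
rewrite !mulr0; have [cab|] := eqVneq c (a * b)%g; last by rewrite mulr0.
by rewrite cab mulgK eqxx in ne.
Qed.

Lemma adjoint_rhoE b S : adjoint_of (rho b) S ->
  forall y c, S y c = (sigma c b)^* * y (c * b)%g.
Proof.
move=> /adjoint_sym bS y c.
by rewrite -l2dot_delta bS rho_delta l2dotZr l2dot_delta.
Qed.

Lemma lambda_rhoC a b : lam a \o rho b = rho b \o lam a.
Proof.
apply/commP => x; apply: ell2_eq => c.
rewrite lambdaE !rhoE lambdaE !mulrA; congr (_ * _); last by rewrite mulgA.
set s := (a^-1 * (c * b^-1))%g.
have -> : (c * b^-1 = a * s)%g by rewrite mulVKg.
have -> : (a^-1 * c = s * b)%g by rewrite /s mulgA mulgVK.
by rewrite mulgK -multA mulrC.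
Qed.

(** Adjoints are added abstractly, as [commutant_von_neumann] needs a family
    stable under them. *)
Definition rho_star : set (H -> H) :=
  [set S | exists b, S = rho b \/ adjoint_of (rho b) S].

Lemma rho_star_bounded : rho_star `<=` @bounded_operator R G.
Proof.
move=> S [b [->|bS]]; first exact: rho_bounded.
apply: adjoint_bounded bS; exact: rho_bounded.
Qed.

Lemma rho_star_stable : star_stable rho_star.
Proof.
move=> S [b [->|bS]].
  have [S' bS'] := adjoint_exists (rho_bounded b).
  by exists S' => //; exists b; right.
by exists (rho b); [exists b; left | exact: adjoint_sym].
Qed.

Lemma lambda_commutant a : commutant rho_star (lam a).
Proof.
split=> [|S [b [->|bS]]]; first exact: lambda_bounded.
  exact: lambda_rhoC.
apply/commP => x; apply: ell2_eq => c.
rewrite lambdaE !(adjoint_rhoE bS) lambdaE.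
have [s ->] : exists s, c = (a * s)%g by exists (a^-1 * c)%g; rewrite mulVKg.
rewrite -!mulgA !mulKg !mulrA; congr (_ * _).
rewrite -[LHS]mulr1 -(mult_conj (a * s)%g b).
transitivity (sigma a s * sigma (a * s)%g b *
              ((sigma s b)^* * (sigma (a * s)%g b)^*)); first by ring.
rewrite multA -mulrA (mulrA (sigma s b)) mult_conj; ring.
Qed.

(** The only place where condition K is used. Comparing coefficients of
    lambda_b x and rho_b x at bc shows that |x| is constant on conjugacy
    classes, and that x vanishes at c as soon as some b commuting with c has
    sigma(b,c) <> sigma(c,b). So the support of x consists of regular classes,
    which are finite because x is square summable. *)
Lemma K_fixed_vector x : condition_K sigma -> (forall b, lam b x = rho b x) ->
  x = x 1%g *: dlt 1%g.
Proof.
move=> K xlr.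
have conjx b c :
    sigma b c * x c = sigma (b * c * b^-1)%g b * x (b * c * b^-1)%g.
  have := congr1 (fun y : H => y (b * c)%g) (xlr b).
  by rewrite lambdaE rhoE mulKg.
suff x0 a : a <> 1%g -> x a = 0.
  apply: ell2_eq => c; rewrite ell2Z deltaE; case: eqVneq => [->|/eqP/x0 ->].
    by rewrite mulr1.
  by rewrite mulr0.
move=> a1; apply/eqP; apply: contrapT => /negP xa0.
have xcl c : conjugacy_class a c -> normc (x c) = normc (x a).
  move=> [b _ <-]; have := congr1 (@normc _) (conjx b^-1%g a).
  by rewrite invgK !normcM !normc_mult !mul1r /conjg mulgA.
have areg : sigma_regular sigma a.
  move=> b ab; apply: (mulIf xa0).
  by rewrite (conjx b a) -(ab : a * b = b * a)%g mulgK.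
have /infinite_set_fset inf : infinite_set (conjugacy_class a).
  apply: K; first by exists a.
  move=> cl1; apply: a1; rewrite -[a = _]/([set 1%g] a) -cl1.
  by exists 1%g => //; rewrite conjg1.
have r0 : 0 < normc (x a) ^+ 2.
  rewrite exprn_gt0 // lt0r normc_ge0 andbT.
  by apply: contra_neq xa0; exact: eq0_normc.
have [n] := ltr_add_invr (divr_gt0 r0 (ltr_pwDr ltr01 (sqr_ge0 (l2norm x)))).
rewrite add0r => nP; have [B Bsub Bn] := inf n.+1.
have := sum_sqr_le_l2norm x (finmap.fset_uniq B).
rewrite (eq_big_seq (fun=> normc (x a) ^+ 2)) => [|c cB]; last first.
  by rewrite xcl //; exact: Bsub.
rewrite big_const_seq count_predT iter_addr addr0 => h.
have : normc (x a) ^+ 2 *+ n.+1 <= l2norm x ^+ 2.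
  by apply: le_trans h; apply: ler_wpMn2l Bn; exact: ltW.
move: nP; rewrite invf_plt ?posrE ?ltr0n //; last first.
  by rewrite divr_gt0 // ltr_pwDr // sqr_ge0.
rewrite invf_div ltr_pdivrMr // mulr_natl; lra.
Qed.

End translations.
(** * What condition K implies *)
Section consequences_of_K.
Variables (R : realType) (G : groupType) (sigma : multiplier R G).
Local Notation H := (ell2 R G).
Local Notation lam := (lambda sigma).
Local Notation dlt := (@delta R G).
Implicit Types (a b c : G) (x y : H) (T S : H -> H).

Lemma lambda_delta1 b : lam b (dlt 1%g) = dlt b.
Proof. by rewrite lambda_delta mult1r scale1r mulg1. Qed.

Lemma rho_delta1 b : rho sigma b (dlt 1%g) = dlt b.
Proof. by rewrite rho_delta mult1l scale1r mul1g. Qed.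

Lemma lambda1 : lam 1%g = id.
Proof.
apply/funext => x; apply: ell2_eq => c.
by rewrite lambdaE invg1 mul1g mult1l mul1r.
Qed.

Lemma range_lambda_bounded : range lam `<=` @bounded_operator R G.
Proof. by move=> _ [a _ <-]; exact: lambda_bounded. Qed.

Lemma commutant_rho_von_neumann :
  von_neumann_algebra (commutant (rho_star sigma)).
Proof.
apply: commutant_von_neumann; first exact: rho_star_bounded.
exact: rho_star_stable.
Qed.

Lemma range_lambda_commutant : range lam `<=` commutant (rho_star sigma).
Proof. by move=> _ [a _ <-]; exact: lambda_commutant. Qed.

Lemma commutant_rhoC T b x :
  commutant (rho_star sigma) T -> T (rho sigma b x) = rho sigma b (T x).
Proof.
move=> [_ TX]; have /commP -> // : T \o rho sigma b = rho sigma b \o T.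
by apply: TX; exists b; left.
Qed.

Variable A : set (H -> H).
Hypothesis Astar : star_subalgebra A.
Hypothesis Alam : range lam `<=` A.
Hypothesis Arho : A `<=` commutant (rho_star sigma).

Lemma lambda_in a : A (lam a). Proof. by apply: Alam; exists a. Qed.

Lemma id_in : A id. Proof. by rewrite -lambda1; exact: lambda_in. Qed.

Lemma scalar_in_center : @scalar_operators R G `<=` algebra_center A.
Proof.
move=> _ [a _ <-]; split; first exact: starZ id_in.
move=> S /(star_bounded Astar)[linS _]; apply/commP => x.
by rewrite -![(_ *: _) _]/(a *: _) linZ.
Qed.

(** For T in the center, lambda_b and rho_b both send T (delta 1) to
    T (delta b), so [K_fixed_vector] makes delta 1 an eigenvector of T, and
    then every delta b is one for the same eigenvalue. *)
Lemma K_trivial_center : condition_K sigma -> trivial_center A.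
Proof.
move=> K; apply/seteqP; split; last exact: scalar_in_center.
move=> T [AT TA]; have Tlam b x : T (lam b x) = lam b (T x).
  by have /commP -> := TA _ (lambda_in b).
have /(K_fixed_vector K) :
    forall b, lam b (T (dlt 1%g)) = rho sigma b (T (dlt 1%g)).
  move=> b; rewrite -Tlam -commutant_rhoC; last exact: Arho.
  by rewrite lambda_delta1 rho_delta1.
set c := T _ _ => Tc; exists c => //.
apply: operator_ext => [||b].
- exact/boundedZ/bounded_id.
- exact: (star_bounded Astar).
rewrite -lambda_delta1 Tlam Tc linZ //.
by have [] := lambda_bounded sigma b.
Qed.

Lemma ideal_nonzero (I : set (H -> H)) : closed_ideal A I -> I <> [set 0] ->
  exists2 T, I T & T <> 0.
Proof.
move=> II I0; apply: contrapT => no; apply: I0.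
apply/seteqP; split=> [T IT|_ ->]; last exact: ideal0 II.
by apply: contrapT => T0; apply: no; exists T.
Qed.

(** Let S in I and T in J be nonzero, with I and J intersecting trivially, so
    that S B T = 0 for all B in A. The closed subspace V of the vectors killed
    by all S B contains the range of T, and it is invariant under A and under
    the right translations. Hence lambda_b and rho_b both send the projection p
    of delta 1 on V to the projection of delta b, and p is a multiple of
    delta 1 by [K_fixed_vector]. If p = 0 then delta 1 is orthogonal to V, hence
    to every lambda_b (T x), and T = 0; otherwise delta 1 is in V, so S kills
    delta 1 and all its right translates, and S = 0. *)
Lemma K_prime : condition_K sigma -> prime_algebra A.
Proof.
move=> K I J II JJ /(ideal_nonzero II)[S IS S0] /(ideal_nonzero JJ)[T JT T0] IJ.
have AS := ideal_sub II IS; have AT := ideal_sub JJ JT.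
have [linT _] := star_bounded Astar AT.
pose F := [set S \o B | B in A].
have FA : F `<=` A by move=> _ [B AB <-]; exact: starM.
pose V := [set x | forall U, F U -> U x = 0].
have Vsub : closed_subspace V.
  by apply: kernel_closed_subspace => U /FA; exact: star_bounded.
have VT x : V (T x).
  move=> _ [B AB <-]; have : (I `&` J) (S \o (B \o T)).
    split; first exact: (Defs.idealMr II IS (starM Astar AB AT)).
    exact: (Defs.idealMl JJ AS (Defs.idealMl JJ AB JT)).
  by rewrite IJ => /(congr1 (@^~ x)).
have VA B x : A B -> V x -> V (B x).
  move=> AB Vx _ [C AC <-]; apply: (Vx (S \o (C \o B))).
  by exists (C \o B) => //; exact: starM.
have Vrho U x : rho_star sigma U -> V x -> V (U x).
  move=> rU Vx W FW; have [_ /(_ _ rU) /commP ->] := Arho (FA _ FW).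
  have [linU _] := rho_star_bounded rU.
  by rewrite Vx // lin0.
have [p Vp porth] := projectionP (dlt 1%g) Vsub.
have orth U U' : bounded_operator U -> adjoint_of U U' ->
    (forall x, V x -> V (U' x)) ->
    forall k, V k -> l2dot (U (dlt 1%g) - U p) k = 0.
  by move=> [linU _] UU' VU' k Vk; rewrite -linB // UU' porth //; exact: VU'.
have plr b : lam b p = rho sigma b p.
  have [L' LL'] := adjoint_exists (lambda_bounded sigma b).
  have [P' PP'] := adjoint_exists (rho_bounded sigma b).
  have rb : rho_star sigma (rho sigma b) by exists b; left.
  apply/eqP; rewrite -subr_eq0; apply/eqP/l2normsq_eq0.
  have Vd : V (lam b p - rho sigma b p).
    rewrite addrC -scaleN1r; apply: (subspaceP Vsub); first exact: Vrho.
    exact/VA/Vp/lambda_in.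
  have := orth _ _ (lambda_bounded sigma b) LL' _ _ Vd.
  have := orth _ _ (rho_bounded sigma b) PP' _ _ Vd.
  rewrite lambda_delta1 rho_delta1 => h1 h2.
  have VL x : V x -> V (L' x).
    by apply: VA; exact: star_adjoint (lambda_in b) LL'.
  have VP x : V x -> V (P' x) by apply: Vrho; exists b; right.
  rewrite {1}(_ : lam b p - rho sigma b p =
                  (dlt b - rho sigma b p) - (dlt b - lam b p)).
    by rewrite l2dotBl h1 // h2 // subrr.
  by rewrite opprB [RHS]addrC addrA subrK.
have pE := K_fixed_vector K plr; set c := p 1%g in pE.
have [c0|c0] := eqVneq c 0.
  apply: T0; apply/funext => x; apply: ell2_eq => t; rewrite ell20.
  have := porth _ (VA _ _ (lambda_in t^-1%g) (VT x)).
  rewrite pE c0 scale0r subr0 l2dot_deltal lambdaE invgK mulg1.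
  move/eqP; rewrite fmorph_eq0 mulf_eq0 (negPf (mult_neq0 _ _ _)) /=.
  by move/eqP.
have V1 : V (dlt 1%g).
  have -> : dlt 1%g = c^-1 *: p + 0.
    by rewrite addr0 pE scalerA mulVf // scale1r.
  by apply: (subspaceP Vsub) => //; exact: subspace0.
have S1 : S (dlt 1%g) = 0.
  by apply: (V1 (S \o id)); exists id => //; exact: id_in.
apply: S0; apply: operator_ext => [||b].
- exact: (star_bounded Astar).
- exact: bounded0.
rewrite -rho_delta1 commutant_rhoC; last exact: Arho.
by have [linr _] := rho_bounded sigma b; rewrite S1 lin0.
Qed.

End consequences_of_K.
(** * A central element when condition K fails *)
Section central_element.
Variables (R : realType) (G : groupType) (sigma : multiplier R G).
Local Notation H := (ell2 R G).
Local Notation lam := (lambda sigma).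
Local Notation dlt := (@delta R G).
Implicit Types (a b c g : G) (x y : H) (T S : H -> H).

Lemma lambdaM a b x : lam a (lam b x) = sigma a b *: lam (a * b)%g x.
Proof.
apply: ell2_eq => c; rewrite ell2Z !lambdaE.
have [s ->] : exists s, c = (a * b * s)%g.
  by exists ((a * b)^-1 * c)%g; rewrite mulVKg.
by rewrite mulKg -!mulgA !mulKg !mulrA multA.
Qed.

Lemma adjoint_lambda g S : adjoint_of (lam g) S ->
  S = (sigma g^-1%g g)^* *: lam g^-1%g.
Proof.
move=> /adjoint_sym gS; apply/funext => y; apply: ell2_eq => t.
rewrite -l2dot_delta gS lambda_delta l2dotZr l2dot_delta.
rewrite -[(_ *: lam _) _]/(_ *: lam _ _) ell2Z lambdaE invgK mulrA.
congr (_ * _); have := multA sigma g^-1%g g t.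
rewrite mulVg mult1l mulr1 => e.
by rewrite e rmorphM /= mulrAC (mulrC (_^*)) mult_conj mul1r.
Qed.

(** The scalar by which the twist deforms conjugation:
    lambda_b lambda_a lambda_b^* = (conj_coef b a) lambda_(b a b^-1). *)
Definition conj_coef b a : R[i] := sigma b a / sigma (b * a * b^-1)%g b.

(** This expresses that conjugating by lambda_(gb) is conjugating by lambda_b
    and then by lambda_g, and is a threefold use of the cocycle identity. *)
Lemma conj_coefM g b a :
  conj_coef (g * b)%g a = conj_coef g (b * a * b^-1)%g * conj_coef b a.
Proof.
rewrite /conj_coef; set a' := (b * a * b^-1)%g.
set a'' := (g * a' * g^-1)%g.
have a'b : (a' * b = b * a)%g by rewrite mulgVK.
have a''g : (a'' * g = g * a')%g by rewrite mulgVK.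
have -> : (g * b * a * (g * b)^-1)%g = a'' by rewrite /a'' /a' invgM !mulgA.
have e1 := multA sigma g b a.
have e2 := multA sigma g a' b; rewrite a'b in e2.
have e3 := multA sigma a'' g b; rewrite a''g in e3.
have n := mult_neq0 sigma.
rewrite mulf_div; apply/eqP; rewrite eqr_div ?mulf_neq0 ?n //; apply/eqP.
apply: (mulIf (n g b)).
transitivity (sigma g b * sigma (g * b)%g a * (sigma a'' g * sigma a' b)).
  by ring.
rewrite e1.
transitivity (sigma g (b * a)%g * sigma a' b * (sigma b a * sigma a'' g)).
  by ring.
rewrite -e2.
transitivity (sigma a'' g * sigma (g * a')%g b * (sigma g a' * sigma b a)).
  by ring.
by rewrite e3; ring.
Qed.

(** Regularity of a is what makes lambda_b lambda_a lambda_b^* depend only on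
    the conjugate b a b^-1. *)
Lemma conj_coef_commute t a : sigma_regular sigma a -> commute a t ->
  conj_coef t a = 1.
Proof.
move=> areg at_; rewrite /conj_coef -[(t * a)%g]at_ mulgK -(areg _ at_).
by rewrite mulfV // mult_neq0.
Qed.

(** For a finite regular class C of a, the operators
    lambda_b lambda_a lambda_b^* depend only on c = b a b^-1 in C; conjugation
    by lambda_g permutes them, so that their sum z commutes with lambda_g. The
    coefficients of z are those of z (delta 1), supported in C. *)
Lemma central_sum : ~ condition_K sigma ->
  forall A : set (H -> H), star_subalgebra A -> range lam `<=` A ->
  exists z, [/\ A z, forall g, z \o lam g = lam g \o z,
    z (dlt 1%g) <> 0 & z (dlt 1%g) 1%g = 0].
Proof.
move=> nK A Astar Alam.
have [a areg [a1 finC]] : exists2 a, sigma_regular sigma a &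
    conjugacy_class a <> [set 1%g] /\ finite_set (conjugacy_class a).
  apply: contrapT => no; apply: nK => C [a areg ->] C1 finC.
  by apply: no; exists a.
set C := conjugacy_class a in a1 finC.
have CE c : C c <-> exists b, c = (b * a * b^-1)%g.
  split=> [[b _ <-]|[b ->]].
    by exists b^-1%g; rewrite invgK /conjg mulgA.
  by exists b^-1%g => //; rewrite /conjg invgK mulgA.
have Ca : C a by apply/CE; exists 1%g; rewrite invg1 mulg1 mul1g.
have Cconj g c : C c -> C (g * c * g^-1)%g.
  by move=> /CE[b ->]; apply/CE; exists (g * b)%g; rewrite invgM !mulgA.
have C1 : ~ C 1%g.
  move=> /CE[b ab]; apply: a1; have {}ab : a = 1%g.
    apply: (mulgI b); apply: (mulIg b^-1%g).
    by rewrite -ab mulg1 mulgV.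
  apply/seteqP; split=> c; first by move=> /CE[d ->]; rewrite ab mulg1 mulgV.
  by move=> ->; rewrite -ab.
have /choice[B BP] : forall c, exists b, C c -> c = (b * a * b^-1)%g.
  move=> c; have [/CE[b cb]|nC] := pselect (C c); first by exists b.
  by exists 1%g.
(* B chooses a conjugator from a to each element of the class. *)
pose f c := conj_coef (B c) a.
have f_conj g c : C c -> f (g * c * g^-1)%g = conj_coef g c * f c.
  move=> Cc; rewrite /f; set b' := B (g * c * g^-1)%g.
  have b'P : (g * c * g^-1 = b' * a * b'^-1)%g by exact/BP/Cconj.
  have cP := BP _ Cc; rewrite [in conj_coef g c]cP -conj_coefM.
  pose t := ((g * B c)^-1 * b')%g.
  have b't : b' = (g * B c * t)%g by rewrite mulVKg.
  have ta : (t * a * t^-1 = a)%g.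
    have : (b' * a * b'^-1 = (g * B c) * a * (g * B c)^-1)%g.
      by rewrite -b'P {1}cP invgM !mulgA.
    rewrite b't => h; apply: (mulgI (g * B c)%g); apply: (mulIg (g * B c)^-1%g).
    by rewrite -h !invgM !mulgA.
  have at_ : commute a t by rewrite /commute -{1}ta mulgVK.
  by rewrite b't conj_coefM ta (conj_coef_commute areg at_) mulr1.
pose s : seq G := finmap.enum_fset (fset_set C).
have us : uniq s by exact: finmap.fset_uniq.
have sC c : (c \in s) = (c \in C) by rewrite /s in_fset_set.
have sCP c : c \in s -> C c by rewrite sC inE.
pose z x : H := \sum_(c <- s) f c *: lam c x.
have Az : A z.
  rewrite /z; elim: (s) => [|c r IH].
    rewrite (_ : (fun x => _) = 0); first exact: star0 Astar.
    by apply/funext => x; rewrite big_nil.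
  rewrite (_ : (fun x => _) =
               f c *: lam c + (fun x => \sum_(c <- r) f c *: lam c x)).
    apply: (starD Astar) => //; apply: (starZ Astar).
    by apply: Alam; exists c.
  by apply/funext => x; rewrite big_cons.
have zlam g : z \o lam g = lam g \o z.
  apply/funext => x /=; have [ling _] := lambda_bounded sigma g.
  have -> : lam g (z x) = \sum_(c <- s) f c *: lam g (lam c x).
    rewrite /z (big_morph (lam g) (linD ling) (lin0 ling)).
    by apply: eq_bigr => c _; rewrite linZ.
  have sp : perm_eq s [seq (g * c * g^-1)%g | c <- s].
    apply: uniq_perm => // [|c].
      by rewrite map_inj_uniq // => c d /mulIg /mulgI.
    apply/idP/mapP => [cs|[d ds ->]].
      exists (g^-1 * c * g)%g; last by rewrite !mulgA mulgV mul1g mulgK.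
      rewrite sC inE; have := Cconj g^-1%g _ (sCP _ cs).
      by rewrite invgK.
    by rewrite sC inE; exact/Cconj/sCP.
  rewrite /z (perm_big _ sp) big_map big_seq [RHS]big_seq.
  apply: eq_bigr => c /sCP Cc; rewrite f_conj // !lambdaM mulgVK !scalerA.
  by rewrite /conj_coef mulrAC mulfVK ?mult_neq0 // mulrC.
have zd t : z (dlt 1%g) t = if t \in s then f t else 0.
  rewrite /z (big_morph (fun y : H => y t) (id1 := 0) (op1 := +%R)) //.
  rewrite (eq_bigr (fun c => f c * (t == c)%:R)) => [|c _]; last first.
    by rewrite lambda_delta1.
  have [ts|ts] := boolP (t \in s).
    rewrite (bigD1_seq t) //= eqxx mulr1 big1 ?addr0 // => c /negPf ct.
    by rewrite eq_sym ct mulr0.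
  rewrite big_seq big1 // => c cs.
  case: eqVneq => [tc|_]; last by rewrite mulr0.
  by rewrite tc cs in ts.
exists z; split=> //.
- move=> z0; have := zd a; rewrite z0 sC mem_set // ell20 => /esym/eqP.
  by rewrite /f /conj_coef mulf_eq0 invr_eq0 !(negPf (mult_neq0 _ _ _)).
- by rewrite zd sC memNset.
Qed.

(** With z as in [central_sum] and z' its adjoint, one of z + z' and i (z - z')
    is nonzero at delta 1. *)
Lemma central_selfadjoint : ~ condition_K sigma ->
  forall A : set (H -> H), star_subalgebra A -> range lam `<=` A ->
  exists k, [/\ A k, adjoint_of k k, forall g, k \o lam g = lam g \o k,
    k (dlt 1%g) <> 0 & k (dlt 1%g) 1%g = 0].
Proof.
move=> nK A Astar Alam; have [z [Az zlam z0 z1]] := central_sum nK Astar Alam.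
have [z' zz'] := adjoint_exists (star_bounded Astar Az).
have Az' : A z' by exact: star_adjoint zz'.
have z'lam g : z' \o lam g = lam g \o z'.
  have [L LL'] := adjoint_exists (lambda_bounded sigma g).
  have zL : z \o L = L \o z.
    rewrite (adjoint_lambda LL'); apply/commP => x.
    rewrite -![(_ *: lam _) _]/(_ *: lam _ _).
    have [linz _] := star_bounded Astar Az.
    by rewrite linZ //; have /commP -> := zlam g^-1%g.
  apply: (adjoint_unique (adjointM (adjoint_sym LL') zz')).
  by rewrite -zL; apply: adjointM => //; exact: adjoint_sym.
have z'1 : z' (dlt 1%g) 1%g = 0.
  by rewrite -l2dot_delta l2dotC -zz' l2dot_delta z1 conjC0.
pose k (u : R[i]) := u *: z + u^* *: z'.
have kE u x : k u x = u *: z x + u^* *: z' x by [].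
have kP u : k u (dlt 1%g) <> 0 -> exists k, [/\ A k, adjoint_of k k,
    forall g, k \o lam g = lam g \o k, k (dlt 1%g) <> 0 & k (dlt 1%g) 1%g = 0].
  move=> ku0; exists (k u); split=> //.
  - by apply: (starD Astar); exact: (starZ Astar).
  - move=> x y; rewrite !kE l2dotDl l2dotDr !l2dotZl !l2dotZr conjCK.
    by rewrite zz' (adjoint_sym zz') addrC.
  - move=> g; apply/commP => x; have [ling _] := lambda_bounded sigma g.
    rewrite !kE (linD ling) !(linZ ling).
    by have /commP -> := zlam g; have /commP -> := z'lam g.
  - by rewrite kE ell2D !ell2Z z1 z'1 !mulr0 addr0.
have [k1|] := pselect (k 1 (dlt 1%g) = 0); last exact: kP.
have [ki|] := pselect (k 'i (dlt 1%g) = 0); last exact: kP.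
case: z0; have := congr1 (fun x => 'i *: x) k1; rewrite scaler0 => k1'.
have := congr2 +%R k1' ki; rewrite addr0 !kE conjC1 conjCi !scale1r scalerDr.
rewrite scaleNr addrACA subrr addr0 -scalerDl => /eqP.
rewrite scaler_eq0 => /orP[|/eqP//].
rewrite -mulr2n mulrn_eq0 orFb => i0.
by have := neq0Ci (R[i] : numClosedFieldType); rewrite i0.
Qed.

End central_element.
(** * Prime algebras have no central zero divisors *)
Section annihilators.
Variables (R : realType) (G : groupType).
Local Notation H := (ell2 R G).
Implicit Types (x y : H) (T S u w : H -> H) (A X I J : set (H -> H)).

Definition annihilator A X : set (H -> H) :=
  [set T | A T /\ forall S, X S -> T \o S = 0].

Lemma comp0P T S : T \o S = 0 <-> forall x, T (S x) = 0.
Proof. by split=> [TS x|TS]; [have := congr1 (@^~ x) TS | apply/funext]. Qed.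

(** An annihilator on the left is only a left ideal in general; stability of X
    under left multiplication by A makes it two-sided. *)
Lemma annihilator_closed_ideal A X : cstar_algebra A ->
  (forall B S, A B -> X S -> X (B \o S)) -> closed_ideal A (annihilator A X).
Proof.
move=> [As An] AX; split.
- by move=> T [].
- by split=> [|S _]; [exact: star0 As | apply/comp0P].
- move=> S T [AS SX] [AT TX]; split=> [|U XU]; first exact: starD.
  move: (SX _ XU) (TX _ XU) => /comp0P SU /comp0P TU; apply/comp0P => x.
  by rewrite -[(_ + _) _]/(S _ + T _) SU TU addr0.
- move=> a T [AT TX]; split=> [|U XU]; first exact: starZ.
  move: (TX _ XU) => /comp0P TU; apply/comp0P => x.
  by rewrite -[(_ *: _) _]/(a *: T _) TU scaler0.
- move=> S T AS [AT TX]; split=> [|U XU]; first exact: starM.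
  have [linS _] := star_bounded As AS.
  by move: (TX _ XU) => /comp0P TU; apply/comp0P => x /=; rewrite TU lin0.
- move=> S T [AS SX] AT; split=> [|U XU]; first exact: starM.
  exact: SX (AX _ _ AT XU).
- move=> T Tb Tapp; split=> [|U XU].
    by apply: An => // eps /Tapp[S [AS _]]; exists S.
  apply/comp0P => x; apply: l2norm_eq0; apply/eqP.
  rewrite eq_le l2norm_ge0 andbT; apply/ler_addgt0Pr => eps eps0; rewrite add0r.
  have n1 : 0 < l2norm (U x) + 1 by rewrite ltr_pwDr ?l2norm_ge0.
  have [S [_ SX] ST] := Tapp _ (divr_gt0 eps0 n1).
  move: (SX _ XU) (ST (U x)) => /comp0P ->; rewrite subr0 => /le_trans; apply.
  rewrite mulrAC ler_pdivrMr // ler_wpM2l ?(ltW eps0) //; lra.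
Qed.

Lemma adjoint0 : adjoint_of (0 : H -> H) 0.
Proof. by move=> x y; rewrite l2dot0l l2dot0r. Qed.

(** If u w = 0 with u, w central and nonzero, the annihilator I of A u contains
    w and the annihilator J of I contains u. The ideal I is stable under
    adjoints because u is normal (u T = 0 amounts to u^* T = 0), so an element T
    of both I and J satisfies T T^* = 0. *)
Lemma prime_center_domain A u w : cstar_algebra A -> A id -> prime_algebra A ->
  algebra_center A u -> algebra_center A w -> u \o w = 0 -> u = 0 \/ w = 0.
Proof.
move=> Acs Aid Apr [Au uA] [Aw wA] uw; have [As _] := Acs.
apply: contrapT => /not_orP[u0 w0].
have lin T : A T -> linear T by move=> /(star_bounded As)[].
pose X := [set B \o u | B in A].
pose I := annihilator A X; pose J := annihilator A I.
have II : closed_ideal A I.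
  apply: annihilator_closed_ideal => // B _ AB [C AC <-].
  by exists (B \o C) => //; exact: starM.
have JJ : closed_ideal A J.
  by apply: annihilator_closed_ideal => // B S; exact: Defs.idealMl.
have uT T : I T -> forall x, u (T x) = 0.
  move=> [AT TX] x; have /commP -> := uA _ AT.
  by apply: (congr1 (@^~ x) (TX u _)); exists id.
have Iw : I w.
  split=> // _ [B AB <-]; apply/comp0P => x /=.
  move: uw (uA _ AB) (uA _ Aw) => /comp0P uw /commP uB /commP uwC.
  by rewrite -uB -uwC uw.
have Ju : J u by split=> // T IT; apply/comp0P; exact: uT.
apply: (Apr I J II JJ).
- by move=> I0; apply: w0; rewrite I0 in Iw.
- by move=> J0; apply: u0; rewrite J0 in Ju.
apply/seteqP; split=> [T [IT [AT TI]]|_ ->]; last first.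
  by split; [exact: ideal0 II | exact: ideal0 JJ].
have [T' TT'] := adjoint_exists (star_bounded As AT).
have [u' uu'] := adjoint_exists (star_bounded As Au).
have AT' : A T' by exact: star_adjoint TT'.
have [Zs _] := center_cstar Acs.
have [Au' u'A] : algebra_center A u' by exact: star_adjoint uu'.
have u'T' x : u' (T' x) = 0.
  have : adjoint_of (u \o T) (T' \o u') by exact: adjointM.
  have -> : u \o T = 0 by apply/comp0P; exact: uT.
  move=> /(adjoint_unique adjoint0) /esym; have /commP -> := u'A _ AT'.
  by move=> /comp0P.
have uT' x : u (T' x) = 0.
  apply: l2normsq_eq0; rewrite uu' l2dotC; have /commP -> := u'A _ Au.
  by rewrite u'T' lin0 ?l2dot0l ?conjC0 //; exact: lin.
have IT' : I T'.
  split=> // _ [B AB <-]; apply/comp0P => x /=.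
  move: (uA _ AB) (uA _ AT') => /commP uB /commP uT'C.
  by rewrite -uB -uT'C uT'.
have T'0 : T' = 0.
  apply/funext => x; apply: l2normsq_eq0.
  by rewrite -TT'; move: (TI _ IT') => /comp0P ->; rewrite l2dot0l.
by apply: adjoint_unique (adjoint_sym TT') _; rewrite T'0; exact: adjoint0.
Qed.

End annihilators.

(** * Square roots in C*-algebras *)
Section square_root.
Variables (R : realType) (G : groupType).
Local Notation H := (ell2 R G).
Implicit Types (x : H) (T S : H -> H).
Variable A : set (H -> H).
Hypotheses (Acs : cstar_algebra A) (Aid : A id).
Variable k : H -> H.
Hypotheses (Ak : A k) (kk : adjoint_of k k).
Hypothesis k1 : forall x, l2norm (k x) <= l2norm x.

Let As : star_subalgebra A. Proof. by case: Acs. Qed.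
Let lin T : A T -> linear T. Proof. by move=> /(star_bounded As)[]. Qed.

(** A square root s of k^2 is sought as 1 - z, where z solves z = (h + z^2) / 2
    for h = 1 - k^2, a contraction because k is one. The iterates y n of this
    equation are compared with those of the scalar equation t = (1 + t^2) / 2
    obtained by putting 1 for h: since a^2 - b^2 = a (a - b) + (a - b) b, the
    norm of y (n+1) - y n is at most t (n+1) - t n. As t n increases and stays
    below 1, the y n converge in norm, to a contraction. *)
Let h : H -> H := id + -1 *: (k \o k).
Let hE x : h x = x - k (k x). Proof. by rewrite -scaleN1r. Qed.
Let Ah : A h.
Proof. by apply: starD => //; apply: starZ => //; exact: starM. Qed.

Let h1 x : l2norm (h x) <= l2norm x.
Proof.
rewrite -ler_sqr ?nnegrE ?l2norm_ge0 // hE l2norm_sqrB -kk -l2norm_sqr_re.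
have : l2norm (k (k x)) ^+ 2 <= l2norm (k x) ^+ 2.
  by rewrite ler_sqr ?nnegrE ?l2norm_ge0.
by have := sqr_ge0 (l2norm (k x)); lra.
Qed.

Let y := fix y n : H -> H :=
  if n is m.+1 then 2^-1 *: (h + (y m \o y m)) else 0.
Let t := fix t n : R := if n is m.+1 then (1 + t m ^+ 2) / 2 else 0.

Let yS n x : y n.+1 x = 2^-1 *: (h x + y n (y n x)). Proof. by []. Qed.
Let tS n : t n.+1 = (1 + t n ^+ 2) / 2. Proof. by []. Qed.

Let Ay n : A (y n).
Proof.
elim: n => [|n IH]; first exact: star0 As.
by apply: starZ => //; apply: starD => //; exact: starM.
Qed.

Let t01 n : 0 <= t n <= 1.
Proof.
elim: n => [|n /andP[? ?]]; first by rewrite lexx ler01.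
by rewrite tS; apply/andP; split; nra.
Qed.
Let t0 n : 0 <= t n. Proof. by case/andP: (t01 n). Qed.
Let t1 n : t n <= 1. Proof. by case/andP: (t01 n). Qed.

Let t_nondecr n m : (n <= m)%N -> t n <= t m.
Proof.
move=> /subnK <-; elim: (m - n)%N => // d IH; apply: le_trans IH _.
by rewrite addSn tS; have := sqr_ge0 (t (d + n)%N - 1); lra.
Qed.

Let normc_half : normc (2^-1 : R[i]) = 2^-1.
Proof.
have -> : (2^-1 : R[i]) = (2^-1 : R)%:C by rewrite fmorphV rmorph_nat.
by rewrite normcC ger0_norm ?invr_ge0.
Qed.

Let y_le n x : l2norm (y n x) <= t n * l2norm x.
Proof.
elim: n x => [|n IH] x; first by rewrite mul0r l2norm0.
rewrite yS l2normZ normc_half tS mulrAC mulrC ler_pM2r ?invr_gt0 //.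
apply: le_trans (l2normD _ _) _; rewrite mulrDl mul1r; apply: lerD => //.
by apply: le_trans (IH _) _; rewrite expr2 -mulrA ler_wpM2l.
Qed.

Let y_step n x : l2norm (y n.+1 x - y n x) <= (t n.+1 - t n) * l2norm x.
Proof.
elim: n x => [|n IH] x.
  rewrite subr0 (_ : t 0 = 0) // subr0; exact: y_le.
rewrite yS [in X in _ - X]yS -scalerBr l2normZ normc_half.
have -> : h x + y n.+1 (y n.+1 x) - (h x + y n (y n x)) =
    y n.+1 (y n.+1 x - y n x) + (y n.+1 (y n x) - y n (y n x)).
  by rewrite opprD addrACA subrr add0r (linB (lin (Ay n.+1))) addrA subrK.
have e : (t n.+2 - t n.+1) * l2norm x = 2^-1 *
   (t n.+1 * ((t n.+1 - t n) * l2norm x) + (t n.+1 - t n) * (t n * l2norm x)).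
  by rewrite [t n.+2]tS [in X in _ - X]tS; field.
rewrite e ler_pM2l ?invr_gt0 //; apply: le_trans (l2normD _ _) _.
apply: lerD.
  by apply: le_trans (y_le _ _) _; rewrite ler_wpM2l.
apply: le_trans (IH _) _; rewrite ler_wpM2l ?subr_ge0 ?t_nondecr //.
Qed.

Let tau := sup (range t).
Let t_sup : has_sup (range t).
Proof. by split; [exists (t 0), 0%N | exists 1 => _ [n _ <-]]. Qed.
Let tau_ge n : t n <= tau.
Proof. by apply: ub_le_sup; [case: t_sup | exists n]. Qed.
Let tau_le1 : tau <= 1.
Proof. by apply: ge_sup; [case: t_sup | move=> _ [n _ <-]]. Qed.

Let tau_vanishing : vanishing (fun n => tau - t n).
Proof.
move=> eps eps0; have [_ [N _ <-] NP] := sup_adherent eps0 t_sup.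
by exists N => n /t_nondecr; rewrite -/tau in NP; lra.
Qed.

Let y_dist n m x : (n <= m)%N ->
  l2norm (y m x - y n x) <= (t m - t n) * l2norm x.
Proof.
move=> /subnK <-; elim: (m - n)%N => [|d IH].
  by rewrite add0n !subrr l2norm0 mul0r.
rewrite addSn; apply: le_trans (l2normB_le _ (y (d + n)%N x) _) _.
have -> : t (d + n).+1 - t n = t (d + n).+1 - t (d + n)%N + (t (d + n)%N - t n).
  by ring.
by rewrite mulrDl; exact: lerD.
Qed.

Let small_eq0 (v : H) (c : R) : 0 <= c ->
  (forall n, l2norm v <= c * (tau - t n)) -> v = 0.
Proof.
move=> c0 vc; apply: l2norm_eq0; apply/eqP; rewrite eq_le l2norm_ge0 andbT.
apply/ler_addgt0Pr => eps eps0; rewrite add0r.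
have c1 : 0 < c + 1 by rewrite ltr_pwDr.
have [N /(_ N (leqnn _)) NP] := tau_vanishing (divr_gt0 eps0 c1).
apply: le_trans (vc N) _; have := tau_ge N.
move: NP; rewrite ltr_pdivlMr //; nra.
Qed.

(** With s = 1 - z the last clause reads s^2 = k^2, so that s plays the role of
    the absolute value of k. That z is a contraction takes the place of the
    positivity of s. *)
Lemma sqrt_one_minus : exists z, [/\ A z, forall x, l2norm (z x) <= l2norm x &
  forall x, x - z x - z (x - z x) = k (k x)].
Proof.
have /choice[z zP] : forall x : H, exists v : H, forall n,
    l2norm (v - y n x) <= (tau - t n) * l2norm x.
  move=> x; apply: (@ell2_complete _ _ (fun n => y n x)
                                   (fun n => (tau - t n) * l2norm x)).
    move=> eps eps0; have n1 : 0 < l2norm x + 1 by rewrite ltr_pwDr ?l2norm_ge0.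
    have [N NP] := tau_vanishing (divr_gt0 eps0 n1).
    exists N => n /NP; have := tau_ge n; have := l2norm_ge0 x.
    rewrite ltr_pdivlMr //; nra.
  move=> n m nm; apply: le_trans (y_dist _ nm) _.
  by rewrite ler_wpM2r ?l2norm_ge0 // lerD2r.
have z1 x : l2norm (z x) <= l2norm x.
  apply: (@le_trans _ _ (tau * l2norm x)); last first.
    by rewrite -[leRHS]mul1r ler_wpM2r ?l2norm_ge0.
  by have := zP x 0%N; rewrite (_ : y 0 x = 0) // (_ : t 0 = 0) // !subr0.
have linz : linear z.
  move=> a x v; apply/eqP; rewrite -subr_eq0; apply/eqP.
  apply: (@small_eq0 _ (l2norm (a *: x + v) + (normc a * l2norm x + l2norm v))).
    by rewrite !addr_ge0 ?mulr_ge0 ?l2norm_ge0 ?normc_ge0.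
  move=> n; have -> : z (a *: x + v) - (a *: z x + z v) =
      (z (a *: x + v) - y n (a *: x + v)) -
      (a *: (z x - y n x) + (z v - y n v)).
    rewrite (lin (Ay n)) scalerBr [X in _ = _ - X]addrACA -opprD opprB.
    by rewrite addrA subrK.
  apply: le_trans (l2normD _ _) _; rewrite l2normN mulrDl mulrC.
  apply: lerD => //.
  apply: le_trans (l2normD _ _) _; rewrite l2normZ mulrDl; apply: lerD.
    by rewrite -mulrA ler_wpM2l ?normc_ge0 // mulrC.
  by rewrite mulrC.
have Az : A z.
  case: Acs => _; apply; first by split=> //; exists 1 => x; rewrite mul1r.
  move=> eps eps0; have [N NP] := tau_vanishing eps0.
  exists (y N) => // x; apply: le_trans (zP x N) _.
  by rewrite ler_wpM2r ?l2norm_ge0 // ltW // NP.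
exists z; split=> // x.
have zB u v : z (u - v) = z u - z v by exact: linB.
suff zE : z x + z x - z (z x) = h x.
  rewrite zB -[k (k x)](subKr x) -hE -zE -[z x + z x - _]addrA.
  by rewrite [in RHS]opprD [in RHS]addrA.
apply/eqP; rewrite -subr_eq0; apply/eqP.
apply: (@small_eq0 _ (4 * l2norm x)); first by rewrite mulr_ge0 ?l2norm_ge0.
move=> n; have -> : z x + z x - z (z x) - h x =
    2 *: (z x - y n.+1 x) - ((z (z x) - y n (z x)) + y n (z x - y n x)).
  rewrite yS (linB (lin (Ay n))) scalerBr scalerA mulfV ?pnatr_eq0 // scale1r.
  rewrite [X in _ = _ - X]addrA subrK opprB; move: (h x) => hx.
  rewrite [in RHS]opprD !addrA subrK.
  by rewrite scaler_nat mulr2n; exact: addrAC.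
have zy u : l2norm (z u - y n u) <= (tau - t n) * l2norm u by exact: zP.
have le1 : l2norm (z x - y n.+1 x) <= (tau - t n) * l2norm x.
  apply: le_trans (zP _ _) _.
  by rewrite ler_wpM2r ?l2norm_ge0 // lerD2l lerN2 t_nondecr.
have le2 : l2norm (z (z x) - y n (z x)) <= (tau - t n) * l2norm x.
  by apply: le_trans (zy _) _; rewrite ler_wpM2l ?subr_ge0.
have le3 : l2norm (y n (z x - y n x)) <= (tau - t n) * l2norm x.
  apply: le_trans (y_le _ _) _; apply: le_trans (zy x).
  by rewrite -[leRHS]mul1r ler_wpM2r ?l2norm_ge0.
apply: le_trans (l2normD _ _) _; rewrite l2normN l2normZ.
rewrite (_ : normc 2 = 2); last first.
  by rewrite -[2 : R[i]](rmorph_nat (real_complex R)) normcC ger0_norm.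
have := l2normD (z (z x) - y n (z x)) (y n (z x - y n x)).
move: le1 le2 le3; rewrite mulrAC -mulrA; lra.
Qed.

End square_root.
(** * The four conditions *)
Section main.
Variables (R : realType) (G : groupType) (sigma : multiplier R G).
Local Notation H := (ell2 R G).
Local Notation lam := (lambda sigma).
Local Notation dlt := (@delta R G).
Implicit Types (x y : H) (T S k : H -> H) (A : set (H -> H)).

Lemma reduced_cstar_cstar : cstar_algebra (reduced_cstar sigma).
Proof. exact/smallest_cstar/range_lambda_bounded. Qed.

Lemma twisted_vN_von_neumann : von_neumann_algebra (twisted_vN sigma).
Proof. exact/smallest_von_neumann/range_lambda_bounded. Qed.

Lemma lambda_reduced_cstar : range lam `<=` reduced_cstar sigma.
Proof. exact: sub_smallest. Qed.

Lemma lambda_twisted_vN : range lam `<=` twisted_vN sigma.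
Proof. exact: sub_smallest. Qed.

Lemma twisted_vN_sub M : von_neumann_algebra M -> range lam `<=` M ->
  twisted_vN sigma `<=` M.
Proof. by move=> MvN lamM T; apply. Qed.

Lemma reduced_cstar_sub_twisted_vN : reduced_cstar sigma `<=` twisted_vN sigma.
Proof.
move=> T; apply; split; last exact: lambda_twisted_vN.
exact/von_neumann_cstar/twisted_vN_von_neumann.
Qed.

Lemma twisted_vN_commutant_rho :
  twisted_vN sigma `<=` commutant (rho_star sigma).
Proof.
apply: twisted_vN_sub; first exact: commutant_rho_von_neumann.
exact: range_lambda_commutant.
Qed.

Lemma twisted_vN_commutes k : bounded_operator k -> adjoint_of k k ->
  (forall g, k \o lam g = lam g \o k) ->
  forall T, twisted_vN sigma T -> k \o T = T \o k.
Proof.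
move=> kb kk klam; have : twisted_vN sigma `<=` commutant [set k].
  apply: twisted_vN_sub.
    apply: commutant_von_neumann => [_ ->//|_ ->].
    by exists k.
  move=> _ [g _ <-]; split; first exact: lambda_bounded.
  by move=> _ ->; rewrite klam.
by move=> sub T /sub[_ Tk]; rewrite Tk.
Qed.

Lemma central_witness : ~ condition_K sigma -> forall A, star_subalgebra A ->
  range lam `<=` A -> A `<=` twisted_vN sigma ->
  exists k, [/\ algebra_center A k, adjoint_of k k,
    k (dlt 1%g) <> 0 & k (dlt 1%g) 1%g = 0].
Proof.
move=> nK A Astar Alam AW.
have [k [Ak kk klam k0 k1]] := central_selfadjoint nK Astar Alam.
exists k; split=> //; split=> // T /AW.
by apply: twisted_vN_commutes => //; exact: star_bounded Ak.
Qed.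

(** A scalar operator is determined by the coefficient at 1 of its value at
    delta 1, which is 0 for the central witness. *)
Lemma trivial_center_K A : star_subalgebra A -> range lam `<=` A ->
  A `<=` twisted_vN sigma -> trivial_center A -> condition_K sigma.
Proof.
move=> Astar Alam AW Atriv; apply: contrapT => nK.
have [k [Zk _ k0 k1]] := central_witness nK Astar Alam AW.
move: Zk; rewrite Atriv => -[a _ kE]; apply: k0.
have kdE : k (dlt 1%g) = a *: dlt 1%g by rewrite -kE.
move: k1; rewrite kdE ell2Z deltaE eqxx mulr1 => ->.
by rewrite scale0r.
Qed.

Lemma contraction_fixed x T : (forall z, l2norm (T z) <= l2norm z) ->
  l2dot (T x) x = l2dot x x -> T x = x.
Proof.
move=> T1 Tx; apply/eqP; rewrite -subr_eq0; apply/eqP/l2norm_eq0.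
apply/eqP; rewrite -sqrf_eq0 eq_le sqr_ge0 andbT l2norm_sqrB Tx l2dotxx ReC.
have : l2norm (T x) ^+ 2 <= l2norm x ^+ 2.
  by rewrite ler_sqr ?nnegrE ?l2norm_ge0.
by lra.
Qed.

(** Let k be the central self-adjoint element given by the failure of K, and s
    the square root of k^2 in the center. Then (s - k) (s + k) = 0, so that
    s = k or s = - k as there are no central zero divisors: k has a constant
    sign. But <k (delta 1), delta 1> = 0, so the contraction y = 1 - s satisfies
    <y (delta 1), delta 1> = <delta 1, delta 1>. It fixes delta 1, hence s, and
    with it k, kills delta 1, a contradiction. *)
Lemma prime_K A : cstar_algebra A -> range lam `<=` A ->
  A `<=` twisted_vN sigma -> prime_algebra A -> condition_K sigma.
Proof.
move=> Acs Alam AW Apr; apply: contrapT => nK; have [Astar _] := Acs.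
have Aid : A id by apply: id_in Alam.
have [k0 [Zk0 kk0 k0d k0e]] := central_witness nK Astar Alam AW.
have [c c0 k0c] := bounded_norm (star_bounded Astar Zk0.1).
have Zcs := center_cstar Acs; have [Zs _] := Zcs.
(* rescaled so as to be a contraction *)
pose k := (c^-1)%:C *: k0.
have kE x : k x = (c^-1)%:C *: k0 x by [].
have Zk : algebra_center A k by exact: starZ.
have kk : adjoint_of k k.
  by move=> x y; rewrite !kE l2dotZl l2dotZr conjcC kk0.
have k1 x : l2norm (k x) <= l2norm x.
  rewrite kE l2normZ normcC ger0_norm ?invr_ge0 ?(ltW c0) //.
  by rewrite mulrC ler_pdivrMr // mulrC.
have Zid : algebra_center A id by split.
have [y [Zy y1 yk]] := sqrt_one_minus Zcs Zid Zk kk k1.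
pose s : H -> H := id - y.
have sE x : s x = x - y x by [].
have sk x : s (s x) = k (k x) by exact: yk.
have Zs' (u : R[i]) : algebra_center A (s + u *: k).
  apply: (starD Zs); last exact: starZ.
  have -> : s = id + -1 *: y by rewrite scaleN1r.
  by apply: (starD Zs) => //; exact: starZ.
have linP T : algebra_center A T -> linear T by move=> /(star_bounded Zs)[].
have lins : linear s by have := linP _ (Zs' 0); rewrite scale0r addr0.
have ks x : k (s x) = s (k x).
  rewrite !sE linB; last exact: linP.
  by have /commP -> := Zk.2 _ Zy.1.
have prod0 : (s + -1 *: k) \o (s + 1 *: k) = 0.
  apply/comp0P => x; rewrite -![(_ + _) _]/(s _ + _ *: k _) scaleN1r scale1r.
  by rewrite (linD lins) sk (linD (linP _ Zk)) ks [X in X - _]addrC subrr.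
have kd0 : k (dlt 1%g) 1%g = 0 by rewrite kE ell2Z k0e mulr0.
suff sd : s (dlt 1%g) = 0.
  apply: k0d; have : k (dlt 1%g) = 0.
    by apply: l2normsq_eq0; rewrite kk -sk sd lin0 // l2dot0r.
  rewrite kE => /eqP; rewrite scaler_eq0 => /orP[|/eqP//].
  by rewrite fmorph_eq0 invr_eq0 gt_eqF.
have [u0 sku] : exists u : R[i], s + u *: k = 0.
  case: (prime_center_domain Acs Aid Apr (Zs' _) (Zs' _) prod0) => ?;
  by [exists (-1) | exists 1].
have sd1 : s (dlt 1%g) 1%g = 0.
  have := congr1 (fun T : H -> H => T (dlt 1%g) 1%g) sku.
  by rewrite -[(_ + _) _]/(s _ + _ *: k _) ell2D ell2Z kd0 mulr0 addr0.
apply/eqP; rewrite sE subr_eq0 eq_sym; apply/eqP/contraction_fixed => //.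
move: sd1; rewrite sE ell2B => /eqP; rewrite subr_eq0 => /eqP yd.
by rewrite !l2dot_delta yd.
Qed.

End main.

Theorem theorem2p7 (R : realType) (G : groupType) (sigma : multiplier R G) :
  [<-> condition_K sigma;
       is_factor (twisted_vN sigma);
       prime_algebra (reduced_cstar sigma);
       trivial_center (reduced_cstar sigma)].
Proof.
have [Wstar _ _] := twisted_vN_von_neumann sigma.
have [Astar _] := reduced_cstar_cstar sigma.
have AW := @reduced_cstar_sub_twisted_vN R G sigma.
have Wrho := @twisted_vN_commutant_rho R G sigma.
have Wlam := @lambda_twisted_vN R G sigma.
have Alam := @lambda_reduced_cstar R G sigma.
have Arho : reduced_cstar sigma `<=` commutant (rho_star sigma).
  exact: subset_trans Wrho.
tfae.
- move=> K; split; first exact: twisted_vN_von_neumann.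
  exact: (K_trivial_center Wstar Wlam Wrho K).
- move=> [_ Wtriv]; apply: (K_prime Astar Alam Arho).
  exact: (trivial_center_K Wstar Wlam (@subset_refl _ _) Wtriv).
- move=> Apr; apply: (K_trivial_center Astar Alam Arho).
  exact: (prime_K (reduced_cstar_cstar sigma) Alam AW Apr).
- exact: (trivial_center_K Astar Alam AW).
Qed.
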